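(* Consider the differential equation $$\frac{\mathrm{d} r_1}{\mathrm{d}t}=r_1\tilde f(\mu,r_1),\qquad \tilde f:=\alpha\left(\mu+a\,r_1^{2p}+b\,r_1^{2q}\right),\qquad \alpha\in\mathbb{R}_{>0},\ p,q\in\mathbb{N},\ q>p,\ ab<0,$$ with parameter $\mu\in\mathbb{R}$. When $\mu$ crosses the transition variety $$T_{2SN}:=\left\{\mu\ \Big|\ \mu=\mu^\star=-a\left(\frac{-pa}{qb}\right)^{\frac{p}{q-p}}\left(\frac{q-p}{q}\right)\right\},$$ the equation exhibits a double (non-standard) saddle-node type of bifurcation. When $a<0$, there are two pairs of equilibria along with the origin when $0<\mu<\mu^\star$; these pairs coalesce and disappear when $\mu$ crosses $T_{2SN}$ and then $\mu>\mu^\star$. For $a>0$, there are four equilibria (apart from the origin) when $\mu^\star<\mu<0$, and the origin is the only equilibrium for $\mu<\mu^\star$. When $a<0$, in terms of the Eulerian differential system $$\dot x_i=-\omega_i y_i+x_i f(\mu,\mathbf{x},\mathbf{y}),\qquad \dot y_i=\omega_i x_i+y_i f(\mu,\mathbf{x},\mathbf{y}),\qquad 0\le i\le n,$$ reduced on the leaf manifold $\mathcal{M}_{\mathbf{c}}$, two hypertori coalesce and disappear when the parameter $\mu$ varies from $0<\mu<\mu^\star$ to $\mu>\mu^\star$.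
   Context: Notation: $\mathbf{x}=(x_0,\dots,x_n)$, $\mathbf{y}=(y_0,\dots,y_n)\in\mathbb{R}^{n+1}$, $\boldsymbol\omega=(\omega_0,\dots,\omega_n)\in\mathbb{R}^{n+1}$, $f\in\mathbb{R}[\mu,x_0^2+y_0^2,\dots,x_n^2+y_n^2]$, and $\mathbf{0}\neq\mathbf{c}=(c_0,\dots,c_n)\in\mathbb{R}^{n+1}_{\ge0}$ (with $c_1\neq0$). A hypertorus is a manifold homeomorphic to the standard $n$-torus; the hypertori meant here are flow-invariant ones. Leaf manifold: $\mathcal{M}_{\mathbf{c}}=\{(\mathbf{u},\mathbf{v})\in\mathbb{R}^{2n+2}:\exists s>0,\ \|(u_i,v_i)\|_2=s\,c_i\text{ for }0\le i\le n\}$, which is flow-invariant. Relation between the scalar equation and the system: writing $f(\mu,\mathbf{x},\mathbf{y})=\widehat f(\mu,x_0^2+y_0^2,\dots,x_n^2+y_n^2)$, the function $\tilde f$ is $\tilde f(\mu,r_1)=\widehat f\big(\mu,\tfrac{c_0^2}{c_1^2}r_1^2,\,r_1^2,\,\tfrac{c_2^2}{c_1^2}r_1^2,\dots,\tfrac{c_n^2}{c_1^2}r_1^2\big)$; on $\mathcal{M}_{\mathbf{c}}$ the amplitude $r_1=\|(x_1,y_1)\|_2$ satisfies the scalar equation and $\|(x_i,y_i)\|_2=\frac{c_i}{c_1}r_1$. Double saddle-node means that two saddle-node type bifurcations take place simultaneously at $\mu=\mu^\star$, at the points $r_1=r_1^{\star,\pm}=\pm\left(\frac{-pa}{qb}\right)^{\frac{1}{2(q-p)}}$.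 *)

(* Defs.v *)
From HB Require Import structures.
From mathcomp Require Import all_boot all_order all_algebra.
From mathcomp Require Import all_classical all_reals all_analysis.
(* Not imported: its notations clash with those of mathcomp-analysis. *)
From mathcomp Require mpoly.
Set Implicit Arguments.
Unset Strict Implicit.
Unset Printing Implicit Defensive.
Import Order.TTheory GRing.Theory Num.Theory.
Import numFieldNormedType.Exports.
Local Open Scope classical_set_scope.
Local Open Scope ring_scope.

(** * Scalar equations  r' = G mu r *)

Definition equilibria (R : realType) (G : R -> R -> R) (mu : R) : set R :=
  [set r | G mu r = 0].

Definition fold_point (R : realType) (G : R -> R -> R) (mu0 r0 : R) : Prop :=
  [/\ G mu0 r0 = 0,
      is_derive r0 1 (G mu0) 0,
      exists2 d, d != 0 & is_derive r0 1 (derive1 (G mu0)) d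
    & exists2 d, d != 0 & is_derive mu0 1 (fun mu => G mu r0) d].

(* The sign [s] tells on which side of [mu0] the equilibria disappear: the
   parameter is [mu0 - s * h] before and [mu0 + s * h] after the collision,
   [h] being a small positive number.  [e] is the size of the neighbourhood of
   [r0] that is observed. The opposite signs of the two derivatives say that
   one of the colliding equilibria is stable and the other one unstable. *)
Definition collision (R : realType) (G : R -> R -> R) (mu0 r0 : R) : Prop :=
  exists (s e : R) (rl rr : R -> R),
  [/\ (s = 1 \/ s = -1) /\ 0 < e,
      \forall h \near 0^'+,
        [/\ rl h < rr h,
            equilibria G (mu0 - s * h) `&` ball r0 e = [set rl h; rr h]
          & derive1 (G (mu0 - s * h)) (rl h) * derive1 (G (mu0 - s * h)) (rr h) < 0],
      (rl h @[h --> 0^'+] --> r0) /\ (rr h @[h --> 0^'+] --> r0),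
      equilibria G mu0 `&` ball r0 e = [set r0]
    & \forall h \near 0^'+, equilibria G (mu0 + s * h) `&` ball r0 e = set0].

Definition saddle_node (R : realType) (G : R -> R -> R) (mu0 r0 : R) : Prop :=
  fold_point G mu0 r0 /\ collision G mu0 r0.

Definition double_saddle_node (R : realType) (G : R -> R -> R)
    (mu0 rplus rminus : R) : Prop :=
  [/\ rplus != rminus, saddle_node G mu0 rplus & saddle_node G mu0 rminus].

Definition ftilde (R : realType) (alpha a b : R) (p q : nat) (mu r : R) : R :=
  alpha * (mu + a * r ^+ (2 * p) + b * r ^+ (2 * q)).

Definition amplitude_field (R : realType) (alpha a b : R) (p q : nat)
    (mu r : R) : R := r * ftilde alpha a b p q mu r.

Definition mustar (R : realType) (a b : R) (p q : nat) : R :=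
  - a * ((- (p%:R * a) / (q%:R * b)) `^ (p%:R / (q%:R - p%:R)))
    * ((q%:R - p%:R) / q%:R).

Definition T2SN (R : realType) (a b : R) (p q : nat) : set R :=
  [set mu | mu = mustar a b p q].

Definition rstar (R : realType) (a b : R) (p q : nat) : R :=
  (- (p%:R * a) / (q%:R * b)) `^ (1 / (2 * (q%:R - p%:R))).

(** * Eulerian systems on R^(2n+2)

   A point is a pair [(x, y)] of row vectors with [n + 1] coordinates. *)

Definition state (R : realType) (n : nat) := ('rV[R]_n.+1 * 'rV[R]_n.+1)%type.

Definition idx1 (n : nat) : 'I_n.+1 := inord 1.

(* The variable of index 0 of [fhat] is the parameter, and the one of index
   [i + 1] stands for [x_i ^ 2 + y_i ^ 2]. *)
Definition eval_fhat (R : realType) (n : nat) (fhat : mpoly.mpoly n.+2 R)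
    (mu : R) (w : 'I_n.+1 -> R) : R :=
  mpoly.meval (fun j : 'I_n.+2 => if unlift ord0 j is Some i then w i else mu)
    fhat.

Definition euler_f (R : realType) (n : nat) (fhat : mpoly.mpoly n.+2 R)
    (mu : R) (x y : 'rV[R]_n.+1) : R :=
  eval_fhat fhat mu (fun i => x ord0 i ^+ 2 + y ord0 i ^+ 2).

Definition reduced_f (R : realType) (n : nat) (fhat : mpoly.mpoly n.+2 R)
    (c : 'rV[R]_n.+1) (mu r : R) : R :=
  eval_fhat fhat mu
    (fun i => c ord0 i ^+ 2 / c ord0 (idx1 n) ^+ 2 * r ^+ 2).

Definition euler_solution (R : realType) (n : nat) (omega : 'rV[R]_n.+1)
    (fhat : mpoly.mpoly n.+2 R) (mu t0 t1 : R) (z : R -> state R n) : Prop :=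
  forall t, t0 < t < t1 -> forall i : 'I_n.+1,
    let: (x, y) := z t in
    is_derive t 1 (fun s => (z s).1 ord0 i)
      (- omega ord0 i * y ord0 i + x ord0 i * euler_f fhat mu x y) /\
    is_derive t 1 (fun s => (z s).2 ord0 i)
      (omega ord0 i * x ord0 i + y ord0 i * euler_f fhat mu x y).

(* Solutions may blow up in finite time, whence the arbitrary interval of
   definition; invariance is required both forward and backward in time. *)
Definition flow_invariant (R : realType) (n : nat) (omega : 'rV[R]_n.+1)
    (fhat : mpoly.mpoly n.+2 R) (mu : R) (S : set (state R n)) : Prop :=
  forall (t0 t1 : R) (z : R -> state R n),
    t0 < 0 < t1 -> euler_solution omega fhat mu t0 t1 z -> S (z 0) ->
    forall t, t0 < t < t1 -> S (z t).

Definition amplitude (R : realType) (n : nat) (z : state R n) (i : 'I_n.+1) : R :=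
  Num.sqrt (z.1 ord0 i ^+ 2 + z.2 ord0 i ^+ 2).

Definition leaf (R : realType) (n : nat) (c : 'rV[R]_n.+1) : set (state R n) :=
  [set z : state R n | exists2 s : R, 0 < s & forall i, amplitude z i = s * c ord0 i].

Definition leaf_level (R : realType) (n : nat) (c : 'rV[R]_n.+1) (rho : R) :
    set (state R n) :=
  leaf c `&` [set z : state R n | amplitude z (idx1 n) = rho].

(** * Hypertori *)

Definition homeomorphic (T U : topologicalType) (A : set T) (B : set U) : Prop :=
  exists (f : T -> U) (g : U -> T),
  [/\ {within A, continuous f} /\ {within B, continuous g},
      set_fun A B f, set_fun B A g,
      {in A, cancel f g} & {in B, cancel g f}].

Definition standard_torus (R : realType) (k : nat) :
    set ('rV[R]_k * 'rV[R]_k)%type :=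
  [set w : 'rV[R]_k * 'rV[R]_k | forall i, w.1 ord0 i ^+ 2 + w.2 ord0 i ^+ 2 = 1].

Arguments standard_torus : clear implicits.

Definition hypertorus (R : realType) (n k : nat) (S : set (state R n)) : Prop :=
  homeomorphic S (standard_torus R k).

(* Convergence for the Hausdorff distance. *)
Definition hausdorff_cvg (R : realType) (M : pseudoMetricType R)
    (F : set_system R) (S : R -> set M) (S0 : set M) : Prop :=
  forall e : R, 0 < e -> \forall mu \near F,
    (forall z, S mu z -> exists2 z0, S0 z0 & ball z0 e z) /\
    (forall z0, S0 z0 -> exists2 z, S mu z & ball z0 e z).

(* The number of nonzero [c_i], which is the dimension of the tori on which the
   amplitudes are constant in [leaf c]. *)
Definition torus_dim (R : realType) (n : nat) (c : 'rV[R]_n.+1) : nat :=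
  #|[pred i : 'I_n.+1 | c ord0 i != 0]|.

(* Main.v *)
(* With r0 = rstar, one has mu + a r^2p + b r^2q = (b / p) (w(r) - v), where
   v = (p / b) (mustar - mu) and w is an even polynomial that does not depend
   on mu, vanishes at r0, is strictly decreasing on [0, r0] and strictly
   increasing beyond r0. Hence the nonzero equilibria are the solutions of
   w(r) = v: there are two on each side of 0 when 0 < v < w(0), they merge at
   +- r0 when v tends to 0, and there is none when v < 0.

   On the leaf, the level of amplitude rho is invariant if and only if rho is a
   zero of ftilde. If it is one, the squared amplitudes solve linear equations
   y' = h y along any solution, so that their ratios, and then the amplitude
   itself, are conserved. If it is not, separation of variables gives a solution
   on which the amplitude exceeds rho at some (positive or negative) time. The
   same solution, started from a point of maximal amplitude of a compact
   invariant set, shows that there is no invariant torus beyond mustar. *)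
Require Import Defs.
From mathcomp Require Import all_boot all_order all_algebra.
From mathcomp Require Import all_classical all_reals all_analysis.
From mathcomp Require mpoly.
From mathcomp Require Import ring lra zify.
Import Order.TTheory GRing.Theory Num.Theory.
Import numFieldNormedType.Exports.
Local Open Scope classical_set_scope.
Local Open Scope ring_scope.

Set Implicit Arguments.
Unset Strict Implicit.
Unset Printing Implicit Defensive.

(** * The potential well w *)

(* For [r0 = rstar a b p q], this times [b / p] is [mu + a r^2p + b r^2q] at the
   critical parameter. *)
Definition well (R : realType) (r0 : R) (p q : nat) : {poly R} :=
  p%:R *: ('X^(2 * q) - (r0 ^+ (2 * q))%:P)
  - (q%:R * r0 ^+ (2 * (q - p))) *: ('X^(2 * p) - (r0 ^+ (2 * p))%:P).

(** The height of the central bump of [well], at the origin; in the scaled variable v it corresponds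
    to mu = 0. *)
Definition well_top (R : realType) (r0 : R) (p q : nat) : R :=
  (q%:R - p%:R) * r0 ^+ (2 * q).

Section Well.
Context {R : realType} (r0 : R) (p q : nat).
Hypotheses (r0_gt0 : 0 < r0) (p_gt0 : (0 < p)%N) (ltpq : (p < q)%N).
Local Notation w := (well r0 p q).

Lemma wellE (x : R) : w.[x] = p%:R * (x ^+ (2 * q) - r0 ^+ (2 * q))
  - q%:R * r0 ^+ (2 * (q - p)) * (x ^+ (2 * p) - r0 ^+ (2 * p)).
Proof. by rewrite /well !hornerE. Qed.

Lemma expr2q (x : R) : x ^+ (2 * q) = x ^+ (2 * p) * x ^+ (2 * (q - p)).
Proof. by rewrite -exprD -mulnDr subnKC// ltnW. Qed.

Lemma well_norm (x : R) : w.[ `|x| ] = w.[x].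
Proof. by rewrite !wellE !exprM !real_normK ?num_real. Qed.

Lemma well_opp (x : R) : w.[- x] = w.[x].
Proof. by rewrite -well_norm normrN well_norm. Qed.

Lemma well_r0 : w.[r0] = 0.
Proof. by rewrite wellE !subrr !mulr0 subrr. Qed.

Lemma well_0 : w.[0] = well_top r0 p q.
Proof.
rewrite wellE /well_top !expr0n !muln_eq0/= !eqn0Ngt p_gt0 (ltn_trans p_gt0 ltpq)/=.
rewrite expr2q; ring.
Qed.

(** Multiplying by x avoids the exponents 2p - 1 and 2q - 1; both monomials then share the factor
    2pq x^(2p), which exposes the sign on either side of r0. *)
Lemma well_deriv (x : R) : x * w^`().[x] =
  (2 * p * q)%:R * (x ^+ (2 * p) * (x ^+ (2 * (q - p)) - r0 ^+ (2 * (q - p)))).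
Proof.
have xX n : (0 < n)%N -> x * (x ^+ n.-1 *+ n) = n%:R * x ^+ n.
  by case: n => // n _; rewrite exprS -mulr_natl mulrCA mulrA.
have q0 := ltn_trans p_gt0 ltpq.
rewrite /well derivB !derivZ !derivB !derivXn !derivC !hornerE/= !hornerMn !hornerXn.
rewrite !subr0 mulrBr !(mulrCA x) !xX ?muln_gt0//.
rewrite !natrM expr2q; ring.
Qed.

Lemma well_deriv_lt0 (x : R) : 0 < x < r0 -> w^`().[x] < 0.
Proof.
move=> /andP[x0 xr]; rewrite -(pmulr_rlt0 _ x0) well_deriv.
rewrite pmulr_rlt0 ?ltr0n ?muln_gt0 ?p_gt0 ?(ltn_trans p_gt0 ltpq)//.
rewrite pmulr_rlt0 ?exprn_gt0// subr_lt0 ltrXn2r ?nnegrE ?ltW//.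
by rewrite muln_eq0/= subn_eq0 -ltnNge.
Qed.

Lemma well_deriv_gt0 (x : R) : r0 < x -> 0 < w^`().[x].
Proof.
move=> xr; have x0 := lt_trans r0_gt0 xr.
rewrite -(pmulr_rgt0 _ x0) well_deriv.
rewrite pmulr_rgt0 ?ltr0n ?muln_gt0 ?p_gt0 ?(ltn_trans p_gt0 ltpq)//.
rewrite pmulr_rgt0 ?exprn_gt0// subr_gt0 ltrXn2r ?nnegrE ?ltW//.
by rewrite muln_eq0/= subn_eq0 -ltnNge.
Qed.

(** Assuming only equality of squares treats r0 and -r0 at once. *)
Lemma well_deriv_r0 (x : R) : x ^+ 2 = r0 ^+ 2 -> w^`().[x] = 0.
Proof.
move=> xr; have x0 : x != 0 by rewrite -sqrf_eq0 xr sqrf_eq0 gt_eqF.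
apply: (mulfI x0); rewrite well_deriv (exprM x 2 (q - p)) xr -exprM subrr.
by rewrite !mulr0.
Qed.

(** Since r0^(2(q-p)) = x^(2(q-p)), the product x^2 w''(x) collapses to 4pq(q - p) x^(2q). *)
Lemma well_deriv2_r0 (x : R) : x ^+ 2 = r0 ^+ 2 -> 0 < w^`()^`().[x].
Proof.
move=> xr; have x0 : x != 0 by rewrite -sqrf_eq0 xr sqrf_eq0 gt_eqF.
have x20 : 0 < x ^+ 2 by rewrite xr exprn_gt0.
rewrite -(pmulr_rgt0 _ x20).
have xX n : (1 < n)%N -> x ^+ 2 * (x ^+ n.-2 *+ n.-1 *+ n) = (n%:R * (n%:R - 1)) * x ^+ n.
  case: n => [//|[//|n]] _ /=; rewrite -mulr_natl -[_ *+ n.+1]mulr_natl.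
  have -> : n.+2%:R - 1 = n.+1%:R :> R by rewrite -[n.+2]addn1 natrD addrK.
  move: n.+1%:R n.+2%:R => u v; rewrite !exprS; ring.
have q0 := ltn_trans p_gt0 ltpq.
rewrite /well !(derivB, derivZ, derivXn, derivC, derivMn, subr0).
rewrite !hornerE/= !hornerMn !hornerXn.
have p1 : (1 < 2 * p)%N by rewrite mul2n -addnn; lia.
have q1 : (1 < 2 * q)%N by rewrite mul2n -addnn; lia.
rewrite mulrBr !(mulrCA (x ^+ 2)) !xX//.
rewrite expr2q -[r0 ^+ _](_ : x ^+ (2 * (q - p)) = _); last first.
  by rewrite exprM xr -exprM.
rewrite (_ : _ - _ = (4 * p%:R * q%:R * (q%:R - p%:R)) *
  (x ^+ (2 * p) * x ^+ (2 * (q - p)))); last first.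
  by rewrite !natrM; ring.
by rewrite !mulr_gt0 ?ltr0n// ?subr_gt0 ?ltr_nat// exprM exprn_gt0.
Qed.

Lemma well_continuous : continuous (horner w).
Proof. exact: continuous_horner. Qed.

Lemma well_decr (x y : R) : 0 <= x -> x < y -> y <= r0 -> w.[y] < w.[x].
Proof.
move=> x0 xy yr; apply: (@ltr0_derive1_lt_cc R (horner w) x y).
- by move=> z _; have [] := is_derive_poly w z.
- move=> z; rewrite in_itv/= => /andP[xz zy]; rewrite -derivE.
  by apply: well_deriv_lt0; rewrite (le_lt_trans x0)// (lt_le_trans zy).
- by apply: continuous_subspaceT; exact: well_continuous.
- by rewrite in_itv/= lexx ltW.
- by rewrite in_itv/= lexx ltW.
- by [].
Qed.

Lemma well_incr (x y : R) : r0 <= x -> x < y -> w.[x] < w.[y].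
Proof.
move=> rx xy; apply: (@gtr0_derive1_lt_cc R (horner w) x y).
- by move=> z _; have [] := is_derive_poly w z.
- move=> z; rewrite in_itv/= => /andP[xz zy]; rewrite -derivE.
  by apply: well_deriv_gt0; exact: le_lt_trans xz.
- by apply: continuous_subspaceT; exact: well_continuous.
- by rewrite in_itv/= lexx ltW.
- by rewrite in_itv/= lexx ltW.
- by [].
Qed.

Lemma well_gt0 (x : R) : `|x| != r0 -> 0 < w.[x].
Proof.
rewrite -well_norm neq_lt -well_r0 => /orP[xr|xr]; first exact: well_decr.
exact: well_incr.
Qed.

Lemma well_ge0 (x : R) : 0 <= w.[x].
Proof.
by have [xr|/well_gt0/ltW//] := eqVneq `|x| r0; rewrite -well_norm xr well_r0.
Qed.

Lemma well_top_gt0 : 0 < well_top r0 p q.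
Proof. by rewrite -well_0 well_gt0// normr0 lt_eqF. Qed.

Lemma well_inj_left (x y : R) : 0 <= x <= r0 -> 0 <= y <= r0 -> w.[x] = w.[y] -> x = y.
Proof.
move=> /andP[x0 xr] /andP[y0 yr] E; case: (ltgtP x y) => // xy.
  by have := well_decr x0 xy yr; rewrite E ltxx.
by have := well_decr y0 xy xr; rewrite E ltxx.
Qed.

Lemma well_inj_right (x y : R) : r0 <= x -> r0 <= y -> w.[x] = w.[y] -> x = y.
Proof.
move=> xr yr E; case: (ltgtP x y) => // xy.
  by have := well_incr xr xy; rewrite E ltxx.
by have := well_incr yr xy; rewrite E ltxx.
Qed.

Lemma well_unbounded (v : R) : exists2 x, r0 < x & v < w.[x].
Proof.
pose C := p%:R * r0 ^+ (2 * q) + `|v|.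
pose k := q%:R * r0 ^+ (2 * (q - p)).
(* C absorbs the constant -p r0^(2q) and the target v; k is the coefficient of the lower power. This
   x satisfies x >= 1 and x - k > C, so x^(2p) (p x^(2(q-p)) - k) > C. *)
pose x := 1 + r0 + k + C.
have k0 : 0 <= k by rewrite mulr_ge0// exprn_ge0// ltW.
have C0 : 0 <= C by rewrite addr_ge0// mulr_ge0// exprn_ge0// ltW.
have x1 : 1 <= x by rewrite /x; move: r0_gt0 k0 C0; lra.
exists x; first by rewrite /x; lra.
have xk : x <= x ^+ (2 * (q - p)).
  by rewrite ler_eXnr// muln_gt0 subn_gt0.
have x2 : 1 <= x ^+ (2 * p) by rewrite exprn_ege1.
have p1 : 1 <= p%:R :> R by rewrite ler1n.
have kr : 0 <= k * r0 ^+ (2 * p) by rewrite mulr_ge0// exprn_ge0// ltW.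
rewrite wellE -/k (expr2q x).
suff : C < x ^+ (2 * p) * (p%:R * x ^+ (2 * (q - p)) - k).
  by move: (ler_norm v) kr; rewrite /C; lra.
have xx : x <= p%:R * x ^+ (2 * (q - p)).
  by rewrite (le_trans xk)// ler_peMl// exprn_ge0// (le_trans ler01).
have xC : C < p%:R * x ^+ (2 * (q - p)) - k.
  rewrite ltrBrDr; apply: lt_le_trans xx.
  by rewrite /x (addrC C) -[ltRHS]addrA ltrDr addr_gt0.
by apply: (lt_le_trans xC); rewrite ler_peMl// (le_trans C0)// ltW.
Qed.

Lemma well_root_left (v : R) : 0 < v < well_top r0 p q -> exists x, 0 < x < r0 /\ w.[x] = v.
Proof.
move=> /andP[v0 vt].
have [||x] := @IVT R (horner w) 0 r0 v (ltW r0_gt0).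
- by apply: continuous_subspaceT; exact: well_continuous.
- by rewrite well_0 well_r0 ge_min le_max (ltW v0) (ltW vt) orbT.
rewrite in_itv/= => /andP[x0 xr] wx; exists x; split => //.
rewrite !lt_neqAle x0 xr !andbT; apply/andP; split; apply/eqP => E.
  by move: vt; rewrite -wx -E well_0 ltxx.
by move: v0; rewrite -wx E well_r0 ltxx.
Qed.

Lemma well_root_right (v : R) : 0 < v -> exists x, r0 < x /\ w.[x] = v.
Proof.
move=> v0; have [y yr yv] := well_unbounded v.
have [||x] := @IVT R (horner w) r0 y v (ltW yr).
- by apply: continuous_subspaceT; exact: well_continuous.
- by rewrite well_r0 ge_min le_max (ltW v0) (ltW yv) orbT.
rewrite in_itv/= => /andP[xr xy] wx; exists x; split => //.
rewrite lt_neqAle xr andbT; apply/eqP => E.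
by move: v0; rewrite -wx -E well_r0 ltxx.
Qed.

End Well.

(** * The two positive roots of w(x) = v as functions of v *)

Definition well_left (R : realType) (r0 : R) (p q : nat) (v : R) : R :=
  xget 0 [set x | 0 < x < r0 /\ (well r0 p q).[x] = v].

(** As for the left root, a choice with default 0 gives a total function of v; monotonicity of w on
    the branch makes the chosen root unique. *)
Definition well_right (R : realType) (r0 : R) (p q : nat) (v : R) : R :=
  xget 0 [set x | r0 < x /\ (well r0 p q).[x] = v].

Section WellRoots.
Context {R : realType} (r0 : R) (p q : nat).
Hypotheses (r0_gt0 : 0 < r0) (p_gt0 : (0 < p)%N) (ltpq : (p < q)%N).
Local Notation w := (well r0 p q).
Local Notation left := (well_left r0 p q).
Local Notation right := (well_right r0 p q).
Local Notation top := (well_top r0 p q).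

Lemma well_leftP (v : R) : 0 < v < top -> 0 < left v < r0 /\ w.[left v] = v.
Proof.
move=> /(well_root_left r0_gt0 p_gt0 ltpq) [x Hx].
by rewrite /well_left; case: xgetP => [y _ //|/(_ x)/=].
Qed.

Lemma well_rightP (v : R) : 0 < v -> r0 < right v /\ w.[right v] = v.
Proof.
move=> /(well_root_right r0_gt0 p_gt0 ltpq) [x Hx].
by rewrite /well_right; case: xgetP => [y _ //|/(_ x)/=].
Qed.

(** Evenness reduces to |x|, which falls on one of the two monotone branches, where w is
    injective. *)
Lemma well_rootP (v x : R) : 0 < v < top ->
  w.[x] = v <-> `|x| = left v \/ `|x| = right v.
Proof.
move=> vt; have [/andP[l0 lr] lv] := well_leftP vt.
have /andP[v0 _] := vt; have [rr rv] := well_rightP v0.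
rewrite -well_norm; split=> [wx|[|] ->//].
have [xr|/ltW xr] := leP `|x| r0.
  left; apply: (well_inj_left (r0 := r0) p_gt0 ltpq);
    rewrite ?normr_ge0 ?(ltW l0) ?(ltW lr) ?wx ?lv//.
by right; apply: (well_inj_right r0_gt0 p_gt0 ltpq); rewrite ?wx ?rv// ltW.
Qed.

(** A monotonicity squeeze: once v < w(r0 - d), the root must lie between r0 - d and r0. *)
Lemma well_left_cvg : left v @[v --> 0^'+] --> r0.
Proof.
apply/cvgrPdist_lt => e e0.
(* Halving keeps d strictly below both e and r0, so that r0 - d stays on the decreasing branch. *)
pose d := Num.min (e / 2) (r0 / 2).
have d0 : 0 < d by rewrite lt_min !divr_gt0.
have de : d < e by rewrite gt_min; rewrite [e / 2 < e]ltr_pdivrMr// ltr_pMr// ltr1n.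
have dr : d < r0 by rewrite gt_min; rewrite [r0 / 2 < r0]ltr_pdivrMr// ltr_pMr// ltr1n orbT.
have wd : 0 < w.[r0 - d].
  by apply: well_gt0 => //; rewrite gtr0_norm ?subr_gt0// lt_eqF// gtrBl.
near=> v.
have vt : 0 < v < top.
  apply/andP; split; near: v; first exact: nbhs_right_gt.
  by apply: nbhs_right_lt; exact: well_top_gt0.
have [/andP[l0 lr] lv] := well_leftP vt.
rewrite gtr0_norm ?subr_gt0//.
suff H : r0 - d < left v by apply: lt_trans de; rewrite ltrBlDr -ltrBlDl.
rewrite ltNge; apply/negP => H.
suff : w.[r0 - d] <= v by apply/negP; rewrite -ltNge; near: v; exact: nbhs_right_lt.
rewrite -lv; move: H; rewrite le_eqVlt => /orP[/eqP-> //|H].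
by apply/ltW/well_decr => //; rewrite ?gerBl ?ltW.
Unshelve. all: by end_near. Qed.

Lemma well_right_cvg : right v @[v --> 0^'+] --> r0.
Proof.
apply/cvgrPdist_lt => e e0.
have wd : 0 < w.[r0 + e].
  by apply: well_gt0 => //; rewrite gtr0_norm ?addr_gt0// gt_eqF// ltrDl.
near=> v.
have v0 : 0 < v by near: v; exact: nbhs_right_gt.
have [rr rv] := well_rightP v0.
rewrite distrC gtr0_norm ?subr_gt0//.
suff H : right v < r0 + e by rewrite ltrBlDl.
rewrite ltNge; apply/negP => H.
suff : w.[r0 + e] <= v by apply/negP; rewrite -ltNge; near: v; exact: nbhs_right_lt.
rewrite -rv; move: H; rewrite le_eqVlt => /orP[/eqP-> //|H].
by apply/ltW/well_incr => //; rewrite lerDl ltW.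
Unshelve. all: by end_near. Qed.

End WellRoots.

(** * Differential equations on the line *)

(** The primitive is the integral from c to x, hence the restriction to c < x. *)
Lemma primitive_exists (R : realType) (k : R -> R) (c : R) :
  continuous k -> exists F : R -> R, forall x, c < x -> is_derive x 1 F (k x).
Proof.
move=> kc.
pose F x := (\int[lebesgue_measure]_(t in [set` `[c, x]]) (k t))%R.
exists F => x cx.
(* The fundamental theorem is applied up to x + 1, so that x is an interior point. *)
have [] := @continuous_FTC1_closed R k c x (x + 1) _ _ cx (kc x).
- by rewrite ltrDl.
- apply: continuous_compact_integrable; first exact: segment_compact.
  exact: continuous_subspaceT.
- move=> dF FE; apply: DeriveDef => //.
  by rewrite -FE derive1E.
Qed.

(** Separation of variables: with F a primitive of 1 / g near rho, the solution is the inverse of F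
    evaluated at F(rho) + t. *)
Lemma scalar_ode_pos (R : realType) (g : R -> R) (rho : R) :
  continuous g -> 0 < g rho ->
  exists2 r : R -> R, r 0 = rho & \forall t \near (0 : R), is_derive (t : R) 1 r (g (r t)).
Proof.
move=> gc grho.
(* The truncation m is positive everywhere, so 1 / m is continuous; it equals g near rho, where g
   exceeds half of g(rho). *)
pose m x := Num.max (g x) (g rho / 2).
have m0 x : 0 < m x by rewrite lt_max (divr_gt0 grho) ?orbT.
have mc : continuous m.
  move=> x; apply: (@continuous_max R R g (cst (g rho / 2)) x (gc x)).
  exact: cvg_cst.
have [|F dF] := @primitive_exists R (fun x => (m x)^-1) (rho - 1).
  by move=> x; apply: cvgV; [rewrite gt_eqF | exact: mc].
pose I := [set` `]rho - 1, rho + 1[].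
have Ic x : I x -> {for x, continuous F}.
  rewrite /I/= in_itv/= => /andP[x1 _].
  apply: differentiable_continuous; apply/derivable1_diffP.
  by have [] := dF _ x1.
have Finc x y : I x -> I y -> x < y -> F x < F y.
  move=> Ix Iy xy.
  apply: (@gtr0_derive1_lt_cc _ F x y) => //.
  - move=> z; rewrite in_itv/= => /andP[xz zy]; have [] // := dF z _.
    by move: Ix; rewrite /I/= in_itv/= => /andP[/lt_trans + _]; apply.
  - move=> z; rewrite in_itv/= => /andP[xz zy].
    rewrite derive1E; have [|_ ->] // := dF z _.
      by move: Ix; rewrite /I/= in_itv/= => /andP[/lt_trans + _]; apply.
    by rewrite invr_gt0.
  - apply: continuous_in_subspaceT => z; rewrite inE/= in_itv/= => /andP[xz zy].
    apply: Ic; move: Ix Iy; rewrite /I/= !in_itv/= => /andP[Ix _] /andP[_ Iy].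
    by rewrite (lt_le_trans Ix)// (le_lt_trans zy).
  - by rewrite in_itv/= lexx ltW.
  - by rewrite in_itv/= lexx ltW.
have Finj x y : I x -> I y -> F x = F y -> x = y.
  move=> Ix Iy E; case: (ltgtP x y) => // xy.
    by have := Finc _ _ Ix Iy xy; rewrite E ltxx.
  by have := Finc _ _ Iy Ix xy; rewrite E ltxx.
(* The inverse of F on the interval, with default value 0 off the image. *)
pose G y := xget 0 [set x | I x /\ F x = y].
have GF x : I x -> G (F x) = x.
  move=> Ix; rewrite /G; case: xgetP => [z _ [Iz Fz]|/(_ x)]; last by case.
  exact: Finj.
have Inbhs x : I x -> \forall y \near x, I y.
  by move=> Ix; apply: open_nbhs_nbhs; split => //; exact: itv_open.
have dG x : I x -> is_derive (F x) 1 G (m x).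
  move=> Ix; have x1 : rho - 1 < x.
    by move: Ix; rewrite /I/= in_itv/= => /andP[].
  rewrite -[m x]invrK; apply: is_derive_inverse.
  - by near=> y; apply: GF; near: y; exact: Inbhs.
  - by near=> y; apply: Ic; near: y; exact: Inbhs.
  - exact: dF.
  - by rewrite invr_eq0 gt_eqF.
have Irho : I rho by rewrite /I/= in_itv/= ltrBlDr ltrDl ltr01.
have [Gc FG] : {near F rho, continuous G} /\ {near F rho, cancel G F}.
  apply: near_can_continuousAcan_sym.
  - by near=> y; apply: GF; near: y; exact: Inbhs.
  - by near=> y; apply: Ic; near: y; exact: Inbhs.
exists (fun t => G (F rho + t)); first by rewrite addr0 GF.
have sh : F rho + t @[t --> 0] --> F rho.
  by rewrite -[X in _ --> X]addr0; apply: cvgD; [exact: cvg_cst|exact: cvg_id].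
have gr : G (F rho + t) @[t --> 0] --> rho.
  rewrite -[X in _ --> X](GF rho)//.
  apply: (@continuous_cvg _ _ _ _ _ (fun t => F rho + t) G _ _ sh).
  exact: nbhs_singleton Gc.
have e1 : \forall t \near (0 : R), I (G (F rho + t)).
  by exact: (gr I (Inbhs _ Irho)).
have e2 : \forall t \near (0 : R), F (G (F rho + t)) = F rho + t by exact: (sh _ FG).
(* For small t the solution stays close to rho, where the truncation is inactive. *)
have e3 : \forall t \near (0 : R), m (G (F rho + t)) = g (G (F rho + t)).
  near=> t; apply/max_idPl; apply: ltW; near: t.
  have : g (G (F rho + t)) @[t --> 0] --> g rho.
    exact: (@continuous_cvg _ _ _ _ _ (fun t => G (F rho + t)) g _ (gc rho) gr).
  by move/cvgr_gt; apply; rewrite gtr_pMr// invf_lt1// ltr1n.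
near=> t.
have -> : g (G (F rho + t)) = m (G (F rho + t)) by rewrite (near e3 t).
have h := dG _ (near e1 t _); rewrite (near e2 t) // in h.
have -> : (fun t => G (F rho + t)) = G \o shift (F rho).
  by apply/funext => s /=; rewrite addrC.
rewrite -[m _]mulr1; apply: is_derive1_comp; last exact: is_derive_shift.
by rewrite /= [t + _]addrC; exact: h.
Unshelve. all: by end_near. Qed.

(** The negative case is the positive one for -g with time reversed. *)
Lemma scalar_ode_local (R : realType) (g : R -> R) (rho : R) :
  continuous g -> g rho != 0 ->
  exists2 r : R -> R, r 0 = rho & \forall t \near (0 : R), is_derive (t : R) 1 r (g (r t)).
Proof.
move=> gc; rewrite neq_lt => /orP[gN|]; last exact: scalar_ode_pos.
have [||r r0 dr] := @scalar_ode_pos R (fun x => - g x) rho.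
- by move=> x; apply: cvgN; exact: gc.
- by rewrite oppr_gt0.
exists (fun t => r (- t)); first by rewrite oppr0.
have := (nearN 0 (fun t : R => is_derive (t : R) 1 r (- g (r t)))).1.
rewrite oppr0 => /(_ dr); apply: filterS => t h.
rewrite -[g _]opprK -mulrN1.
exact: (@is_derive1_comp R r -%R).
Qed.

(** If r never exceeded rho, it would be maximal at the interior time 0, forcing r'(0) = g(rho) to
    vanish. The time found may have either sign, which suits two-sided invariance. *)
Lemma scalar_ode_increase (R : realType) (g : R -> R) (rho : R) :
  continuous g -> g rho != 0 ->
  exists (e : R) (r : R -> R) (t : R),
    [/\ r 0 = rho, - e < t < e, rho < r t
      & forall t, - e < t < e -> is_derive (t : R) 1 r (g (r t))].
Proof.
move=> gc gn; have [r r0 dr] := scalar_ode_local gc gn.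
have /nbhs_ballP[e /= e0 he] := dr.
have {}he t : - e < t < e -> is_derive (t : R) 1 r (g (r t)).
  by move=> te; apply: he; rewrite /ball/= sub0r normrN ltr_norml.
have [t te rt] : exists2 t, - e < t < e & rho < r t.
  apply: contrapT => H.
  have z0 : (0 : R) \in `]- e, e[ by rewrite in_itv/= oppr_lt0 e0.
  have : is_derive (0 : R) 1 r 0.
    apply: (@derive1_at_max R r (- e) e) => //.
    - by rewrite ge0_cp// ltW.
    - by move=> t; rewrite in_itv/= => /he[].
    - move=> t; rewrite in_itv/= => te; rewrite leNgt r0; apply/negP => rt.
      by apply: H; exists t.
  move=> -[_ E]; have [_ E'] := he 0 z0.
  by move: gn; rewrite -r0 -E' E eqxx.
by exists e, r, t.
Qed.

(** A Gronwall argument: with M the maximum of h on [0, T], the function y^2 exp(-2Mt) is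
    nonincreasing, nonnegative and zero at 0. *)
Lemma linear_ode_zero_right (R : realType) (h y : R -> R) (T : R) :
  0 <= T -> {within `[0, T], continuous h} ->
  (forall t, 0 <= t <= T -> is_derive (t : R) 1 y (h t * y t)) ->
  y 0 = 0 -> y T = 0.
Proof.
move=> T0 hc dy y0.
have [c _ hM] := EVT_max T0 hc.
set M := h c in hM.
pose w := (y ^+ 2) * (expR \o ( *%R (- (M *+ 2)))).
have dw t : 0 <= t <= T ->
    is_derive (t : R) 1 w ((h t - M) * (y t ^+ 2 * expR (- (M *+ 2) * t)) *+ 2).
  move=> tT; have dyt := dy _ tT.
  have de : is_derive t 1 (expR \o ( *%R (- (M *+ 2))))
      (expR (- (M *+ 2) * t) * (- (M *+ 2))).
    apply: is_derive1_comp.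
    by apply: is_derive_eq; rewrite ?mulr1 /GRing.scale/= ?mulr1.
  apply: is_derive_eq; rewrite /GRing.scale/= !fctE/=.
  by rewrite expr1 mulr2n; ring.
have : w T <= w 0.
  apply: (@ler0_derive1_le_cc R w 0 T).
  - by move=> t; rewrite in_itv/= => /andP[a b]; have [] // := dw t _; rewrite !ltW.
  - move=> t; rewrite in_itv/= => /andP[a b]; rewrite derive1E.
    have tT : 0 <= t <= T by rewrite !ltW.
    have [_ ->] := dw t tT.
    rewrite -mulr_natr mulr_le0_ge0// mulr_le0_ge0//.
      by rewrite subr_le0; apply: hM; rewrite in_itv.
    by rewrite mulr_ge0 ?sqr_ge0 ?expR_ge0.
  - apply: derivable_within_continuous => t; rewrite in_itv/= => tT.
    by have [] := dw t tT.
  - by rewrite in_itv/= lexx T0.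
  - by rewrite in_itv/= lexx T0.
  - by [].
rewrite /w !fctE/= y0 expr0n/= mul0r pmulr_lle0 ?expR_gt0// => yT.
by apply/eqP; rewrite -sqrf_eq0 eq_le yT sqr_ge0.
Qed.

Lemma linear_ode_zero (R : realType) (h y : R -> R) (t0 t1 : R) :
  (forall t, t0 < t < t1 -> {for t, continuous h}) ->
  (forall t, t0 < t < t1 -> is_derive (t : R) 1 y (h t * y t)) ->
  t0 < 0 < t1 -> y 0 = 0 -> forall t, t0 < t < t1 -> y t = 0.
Proof.
move=> hc dy /andP[t00 t10] y0 t /andP[tl tr]; have [t_ge0|t_lt0] := leP 0 t.
  apply: (@linear_ode_zero_right R h) => //.
  - apply: continuous_in_subspaceT => s; rewrite inE/= in_itv/= => /andP[s0 st].
    by apply: hc; rewrite (lt_le_trans t00)// (le_lt_trans st).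
  - by move=> s /andP[s0 st]; apply: dy; rewrite (lt_le_trans t00)// (le_lt_trans st).
have in_range s : 0 <= s -> s <= - t -> t0 < - s < t1.
  move=> s0 st; rewrite (lt_le_trans tl) 1?lerNr//=.
  by rewrite (le_lt_trans _ t10)// oppr_le0.
(* For negative t, time is reversed: s -> y(-s) solves the linear equation with coefficient
   -h(-s). *)
rewrite -[t]opprK.
apply: (@linear_ode_zero_right R (fun s => - h (- s)) (y \o -%R)).
- by rewrite oppr_ge0 ltW.
- apply: continuous_in_subspaceT => s; rewrite inE/= in_itv/= => /andP[s0 st].
  apply: cvgN; apply: (@continuous_comp _ _ _ -%R h); first exact: opp_continuous.
  exact/hc/in_range.
- move=> s /andP[s0 st]; rewrite mulNr -mulrN1 /=; have := dy _ (in_range _ s0 st).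
  by move=> ?; exact: is_derive1_comp.
- by rewrite /= oppr0.
Qed.

Lemma meval_comp_continuous (R : realType) (T : topologicalType) (n : nat)
    (f : mpoly.mpoly n R) (v : T -> 'I_n -> R) (t : T) :
  (forall i, {for t, continuous (v ^~ i)}) ->
  {for t, continuous (fun s => mpoly.meval (v s) f)}.
Proof.
move=> vc; rewrite /prop_for/= /continuous_at mpoly.mevalE.
under eq_fun do rewrite mpoly.mevalE.
apply: (cvg_big (@add_continuous R)) => m _.
apply: cvgM; first exact: cvg_cst.
apply: (cvg_big (@mul_continuous R)) => i _.
have := @continuous_comp _ _ _ (v ^~ i) (fun x : R => x ^+ mpoly.fun_of_multinom m i) t (vc i).
by apply; exact: exprn_continuous.
Qed.

(** * Eulerian systems and their leaves *)

(** Unlike the amplitude, its square is differentiable along solutions even where it vanishes. *)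
Definition sqamp (R : realType) (n : nat) (z : state R n) (i : 'I_n.+1) : R :=
  z.1 ord0 i ^+ 2 + z.2 ord0 i ^+ 2.

Lemma sqamp_ge0 (R : realType) (n : nat) (z : state R n) i : 0 <= sqamp z i.
Proof. by rewrite addr_ge0 ?sqr_ge0. Qed.

Lemma amplitudeE (R : realType) (n : nat) (z : state R n) i (r : R) :
  0 <= r -> amplitude z i = r <-> sqamp z i = r ^+ 2.
Proof.
move=> r0; rewrite /amplitude -/(sqamp z i); split => [<-|->].
  by rewrite sqr_sqrtr ?sqamp_ge0.
by rewrite sqrtr_sqr ger0_norm.
Qed.

(** The coordinate [idx1 n], where c is positive, fixes the scale s = rho / c_1; membership becomes
    a system of equations on squares. *)
Lemma leaf_levelP (R : realType) (n : nat) (c : 'rV[R]_n.+1) (rho : R) (z : state R n) :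
  (forall i, 0 <= c ord0 i) -> c ord0 (idx1 n) != 0 -> 0 < rho ->
  leaf_level c rho z <->
  forall i, sqamp z i = (rho / c ord0 (idx1 n) * c ord0 i) ^+ 2.
Proof.
move=> hc hc1 rho0; have c1 : 0 < c ord0 (idx1 n) by rewrite lt_neqAle eq_sym hc1 hc.
have nn i : 0 <= rho / c ord0 (idx1 n) * c ord0 i.
  by rewrite mulr_ge0 ?hc// divr_ge0 ?hc// ltW.
split=> [[[s s0 zs]] /= z1 i|zE].
  apply/amplitudeE => //; rewrite zs; congr (_ * _).
  by apply: (mulIf hc1); rewrite -zs z1 divfK.
split.
  by exists (rho / c ord0 (idx1 n)) => [|i]; [rewrite divr_gt0 | apply/amplitudeE].
by rewrite /= ; apply/amplitudeE; rewrite ?ltW// zE divfK.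
Qed.

Lemma euler_f_leaf (R : realType) (n : nat) (fhat : mpoly.mpoly n.+2 R)
    (c : 'rV[R]_n.+1) (mu r : R) (x y : 'rV[R]_n.+1) :
  (forall i, x ord0 i ^+ 2 + y ord0 i ^+ 2 =
     c ord0 i ^+ 2 / c ord0 (idx1 n) ^+ 2 * r ^+ 2) ->
  euler_f fhat mu x y = reduced_f fhat c mu r.
Proof.
move=> H; apply: mpoly.meval_eq => j.
by case: (unlift ord0 j) => [i|//]; rewrite H.
Qed.

(** In 2xx' + 2yy' the rotation terms in omega cancel and only the radial factor f remains. *)
Lemma euler_sqamp_derive (R : realType) (n : nat) (omega : 'rV[R]_n.+1)
    (fhat : mpoly.mpoly n.+2 R) (mu t0 t1 : R) (z : R -> state R n) (i : 'I_n.+1) (t : R) :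
  euler_solution omega fhat mu t0 t1 z -> t0 < t < t1 ->
  is_derive t 1 (fun s => sqamp (z s) i)
    (2 * euler_f fhat mu (z t).1 (z t).2 * sqamp (z t) i).
Proof.
move=> sol tt; have := sol _ tt i; rewrite /sqamp.
case zt: (z t) => [x y] /= [dx dy].
rewrite (_ : (fun s => _) =
  (fun s => (z s).1 ord0 i) ^+ 2 + (fun s => (z s).2 ord0 i) ^+ 2); last first.
  by apply/funext => s; rewrite !fctE.
apply: is_derive_eq; rewrite /GRing.scale/= !expr1 !zt/=; ring.
Qed.

Lemma euler_f_continuous (R : realType) (n : nat) (omega : 'rV[R]_n.+1)
    (fhat : mpoly.mpoly n.+2 R) (mu t0 t1 : R) (z : R -> state R n) (t : R) :
  euler_solution omega fhat mu t0 t1 z -> t0 < t < t1 ->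
  {for t, continuous (fun s => euler_f fhat mu (z s).1 (z s).2)}.
Proof.
move=> sol tt; apply: (@meval_comp_continuous R R) => j.
case: (unlift ord0 j) => [i|]; last exact: cvg_cst.
apply: differentiable_continuous; apply/derivable1_diffP.
by have [] := euler_sqamp_derive i sol tt.
Qed.

(** Writing the reduced f as P(r^2) gives access to the factor theorem: the defects of
    proportionality, and then A_1 - rho^2, solve homogeneous linear equations with zero initial
    value. *)
Lemma leaf_level_invariant (R : realType) (n : nat) (omega c : 'rV[R]_n.+1)
    (fhat : mpoly.mpoly n.+2 R) (mu rho : R) (P : {poly R}) :
  (forall i, 0 <= c ord0 i) -> c ord0 (idx1 n) != 0 ->
  (forall r, reduced_f fhat c mu r = P.[r ^+ 2]) ->
  0 < rho -> root P (rho ^+ 2) ->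
  flow_invariant omega fhat mu (leaf_level c rho).
Proof.
move=> hc hc1 hf rho0 /factor_theorem[Q PQ] t0 t1 z t01 sol.
move=> /(leaf_levelP _ hc hc1 rho0) z0 t tt.
apply/(leaf_levelP _ hc hc1 rho0).
pose k i := c ord0 i ^+ 2 / c ord0 (idx1 n) ^+ 2.
pose f s := 2 * euler_f fhat mu (z s).1 (z s).2.
have kE i : (rho / c ord0 (idx1 n) * c ord0 i) ^+ 2 = k i * rho ^+ 2.
  by rewrite /k; field.
have k1 : k (idx1 n) = 1 by rewrite /k divff// expf_neq0.
pose A i s := sqamp (z s) i.
have dA i s : t0 < s < t1 -> is_derive (s : R) 1 (A i) (f s * A i s).
  by move=> ss; exact: euler_sqamp_derive sol ss.
(* All squared amplitudes share the rate f, so the defect A_i - k_i A_1 solves y' = f y. *)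
have prop i s : t0 < s < t1 -> A i s = k i * A (idx1 n) s.
  move=> ss; apply/eqP; rewrite -subr_eq0; apply/eqP.
  apply: (@linear_ode_zero R f (fun s => A i s - k i * A (idx1 n) s) t0 t1) => //.
  - move=> u uu; apply: cvgM; first exact: cvg_cst.
    exact: euler_f_continuous sol uu.
  - move=> u uu; have := dA i _ uu; have := dA (idx1 n) _ uu => d1 d2.
    rewrite (_ : (fun _ => _) = A i - k i *: A (idx1 n)); last first.
      by apply/funext => v; rewrite !fctE.
    by apply: is_derive_eq; rewrite /GRing.scale/=; ring.
  - by rewrite /A !z0 !kE k1 mul1r subrr.
(* Conserved proportions reduce f to the scalar polynomial at r^2 = A_1. *)
have fE s : t0 < s < t1 -> f s = 2 * P.[A (idx1 n) s].
  move=> ss; rewrite /f.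
  rewrite (@euler_f_leaf _ _ _ c mu (Num.sqrt (A (idx1 n) s))).
    by rewrite hf sqr_sqrtr// sqamp_ge0.
  by move=> i; rewrite sqr_sqrtr ?sqamp_ge0// -[LHS]/(A i s) prop.
suff E s : t0 < s < t1 -> A (idx1 n) s = rho ^+ 2.
  by move=> i; rewrite kE -[LHS]/(A i t) prop// E.
move=> ss; apply/eqP; rewrite -subr_eq0; apply/eqP.
(* As P = Q (X - rho^2), the equation A_1' = 2 P(A_1) A_1 is linear in A_1 - rho^2 with coefficient
   2 Q(A_1) A_1. *)
apply: (@linear_ode_zero R (fun s => 2 * Q.[A (idx1 n) s] * A (idx1 n) s)
          (fun s => A (idx1 n) s - rho ^+ 2) t0 t1) => //.
- move=> u uu.
  have cA : {for u, continuous (A (idx1 n))}.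
    by apply: differentiable_continuous; apply/derivable1_diffP; have [] := dA (idx1 n) _ uu.
  apply: cvgM => //; apply: cvgM; first exact: cvg_cst.
  by apply: (@continuous_comp _ _ _ (A (idx1 n)) (horner Q)) => //; exact: continuous_horner.
- move=> u uu; have := dA (idx1 n) _ uu => d1.
  rewrite (_ : (fun _ => _) = A (idx1 n) - cst (rho ^+ 2)); last first.
    by apply/funext => v; rewrite !fctE.
  apply: is_derive_eq; rewrite fE// PQ hornerM hornerXsubC; ring.
- by rewrite /A z0 kE k1 mul1r subrr.
Qed.

(** The invariant set contains an explicit local solution through z0, whose amplitude follows the
    scalar equation and so exceeds rho at some past or future time. *)
Lemma leaf_level_escape (R : realType) (n : nat) (omega c : 'rV[R]_n.+1)
    (fhat : mpoly.mpoly n.+2 R) (mu rho : R) (P : {poly R})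
    (S : set (state R n)) (z0 : state R n) :
  (forall i, 0 <= c ord0 i) -> c ord0 (idx1 n) != 0 ->
  (forall r, reduced_f fhat c mu r = P.[r ^+ 2]) ->
  0 < rho -> ~~ root P (rho ^+ 2) ->
  flow_invariant omega fhat mu S -> S z0 -> leaf_level c rho z0 ->
  exists2 z, S z & rho < amplitude z (idx1 n).
Proof.
move=> hc hc1 hf rho0 nroot inv Sz0 /(leaf_levelP _ hc hc1 rho0) z0E.
have gc : continuous (fun r : R => r * P.[r ^+ 2]).
  move=> r; apply: cvgM; first exact: cvg_id.
  apply: (@continuous_comp _ _ _ (fun r : R => r ^+ 2) (horner P)).
    exact: exprn_continuous.
  exact: continuous_horner.
have [|e [r [t [r0 te rt dr]]]] := @scalar_ode_increase R _ rho gc.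
  by apply: mulf_neq0 => //; rewrite gt_eqF.
(* Polar coordinates made explicit: plane i of z0 is rotated by the angle omega_i s and dilated by
   r(s) / rho. *)
pose z s : state R n :=
  (\row_i (r s / rho * (cos (omega ord0 i * s) * z0.1 ord0 i
                        - sin (omega ord0 i * s) * z0.2 ord0 i)),
   \row_i (r s / rho * (sin (omega ord0 i * s) * z0.1 ord0 i
                        + cos (omega ord0 i * s) * z0.2 ord0 i))).
have zA s i : sqamp (z s) i = c ord0 i ^+ 2 / c ord0 (idx1 n) ^+ 2 * r s ^+ 2.
  have := z0E i; rewrite /sqamp /z/= !mxE => H.
  have cs := cos2Dsin2 (omega ord0 i * s).
  transitivity ((r s / rho) ^+ 2 * (cos (omega ord0 i * s) ^+ 2 + sin (omega ord0 i * s) ^+ 2)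
      * (z0.1 ord0 i ^+ 2 + z0.2 ord0 i ^+ 2)); first by ring.
  by rewrite cs mulr1 H; field; rewrite hc1 gt_eqF.
have z_0 : z 0 = z0.
  rewrite /z r0 divff ?gt_eqF//; case: z0 {Sz0 z0E z zA} => x y; congr pair;
  apply/rowP => i; rewrite !mxE mulr0 cos0 sin0; ring.
have zsol : euler_solution omega fhat mu (- e) e z.
  move=> s se i; have fz : euler_f fhat mu (z s).1 (z s).2 = P.[r s ^+ 2].
    by rewrite (@euler_f_leaf _ _ _ c mu (r s)) ?hf// => j; exact: zA.
  case zs : (z s) => [x y] /=; rewrite zs /= in fz; rewrite fz.
  have drs := dr _ se.
  have dc : is_derive (s : R) 1 (cos \o ( *%R (omega ord0 i)))
      (- sin (omega ord0 i * s) * omega ord0 i).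
    apply: is_derive1_comp. by apply: is_derive_eq; rewrite /GRing.scale/= ?mulr1.
  have ds : is_derive (s : R) 1 (sin \o ( *%R (omega ord0 i)))
      (cos (omega ord0 i * s) * omega ord0 i).
    by apply: is_derive1_comp; apply: is_derive_eq; rewrite /GRing.scale/= ?mulr1.
  have := congr1 (fun w : state R n => w.1 ord0 i) zs.
  have := congr1 (fun w : state R n => w.2 ord0 i) zs.
  rewrite /= !mxE => <- <-; split.
  - rewrite (_ : (fun _ => _) = rho^-1 *: (r * (z0.1 ord0 i *: (cos \o ( *%R (omega ord0 i)))
        - z0.2 ord0 i *: (sin \o ( *%R (omega ord0 i)))))); last first.
      by apply/funext => u; rewrite mxE !fctE /GRing.scale/=; ring.
    by apply: is_derive_eq; rewrite !fctE /GRing.scale/=; ring.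
  - rewrite (_ : (fun _ => _) = rho^-1 *: (r * (z0.1 ord0 i *: (sin \o ( *%R (omega ord0 i)))
        + z0.2 ord0 i *: (cos \o ( *%R (omega ord0 i)))))); last first.
      by apply/funext => u; rewrite mxE !fctE /GRing.scale/=; ring.
    by apply: is_derive_eq; rewrite !fctE /GRing.scale/=; ring.
exists (z t).
  have e0 : 0 < e by by case/andP: te => ? ?; lra.
  apply: (inv (- e) e z) => //; last by rewrite z_0.
  by rewrite oppr_lt0 e0.
have rt0 := lt_trans rho0 rt.
suff -> : amplitude (z t) (idx1 n) = r t by [].
by apply/amplitudeE; rewrite ?ltW// zA divff ?mul1r// expf_neq0.
Qed.

(** * Leaf levels as tori: topology, limits and invariance *)

Lemma continuous_row (R : realType) (T : topologicalType) (k : nat)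
    (h : T -> 'I_k -> R) :
  (forall j, continuous (h ^~ j)) -> continuous (fun t => \row_j h t j).
Proof.
move=> hc t; apply/cvg_ballP => e e0.
have : \forall s \near t, forall j, ball (h t j) e (h s j).
  by apply: filter_forall => j; exact: (cvg_ballP (h ^~ j) _).1 (hc j t) e e0.
apply: filterS => s H; split => // i j; rewrite !mxE; exact: H.
Qed.

Lemma continuous_coord_sqnorm (R : realType) (k : nat) (j : 'I_k) :
  continuous (fun z : 'rV[R]_k * 'rV[R]_k => z.1 ord0 j ^+ 2 + z.2 ord0 j ^+ 2).
Proof.
have sqc : continuous (fun x : 'rV[R]_k => x ord0 j ^+ 2).
  move=> x; apply: (@continuous_comp _ _ _ _ (fun r : R => r ^+ 2)).
    exact: coord_continuous.
  exact: exprn_continuous.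
move=> z; apply: cvgD.
- by apply: (@continuous_comp _ _ _ fst _ z _ (sqc z.1)); exact: cvg_fst.
- by apply: (@continuous_comp _ _ _ snd _ z _ (sqc z.2)); exact: cvg_snd.
Qed.

(** A level is a product of circles of radii d_i, reduced to a point when c_i = 0. The homeomorphism
    drops the degenerate planes and divides the others by d_i. *)
Lemma leaf_level_hypertorus (R : realType) (n : nat) (c : 'rV[R]_n.+1) (rho : R) :
  (forall i, 0 <= c ord0 i) -> c ord0 (idx1 n) != 0 -> 0 < rho ->
  hypertorus (torus_dim c) (leaf_level c rho).
Proof.
move=> hc hc1 rho0.
pose d i := rho / c ord0 (idx1 n) * c ord0 i.
have c1 : 0 < c ord0 (idx1 n) by rewrite lt_neqAle eq_sym hc1 hc.
have levelP z := leaf_levelP z hc hc1 rho0.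
pose A := [pred i : 'I_n.+1 | c ord0 i != 0].
have d0 j : d (enum_val (j : 'I_#|A|)) != 0.
  apply: mulf_neq0; last exact: (enum_valP j).
  by rewrite gt_eqF// divr_gt0.
pose proj (x : 'rV[R]_n.+1) : 'rV[R]_(torus_dim c) :=
  \row_(j < #|A|) (x ord0 (enum_val j) / d (enum_val j)).
(* [pick] recovers the rank of i among the nonzero entries of c; where there is none, the coordinate
   is restored as 0. *)
pose emb (w : 'rV[R]_(torus_dim c)) : 'rV[R]_n.+1 :=
  \row_i if [pick j : 'I_#|A| | enum_val j == i] is Some j then d i * w ord0 j else 0.
have projc : continuous proj.
  apply: continuous_row => j x; apply: (@cvgM R _ (nbhs x)); last exact: cvg_cst.
  exact: coord_continuous.
have embc : continuous emb.
  apply: continuous_row => i x; case: pickP => [j _|_]; last exact: (@cvg_cst R 0 _ (nbhs x)).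
  apply: (@cvgM R _ (nbhs x)); first exact: cvg_cst.
  exact: coord_continuous.
have pairc (V W : topologicalType) (f : V -> W) :
    continuous f -> continuous (fun z : V * V => (f z.1, f z.2)).
  move=> fc z; apply: cvg_pair.
    by apply: (@continuous_comp _ _ _ fst f); [exact: cvg_fst|exact: fc].
  by apply: (@continuous_comp _ _ _ snd f); [exact: cvg_snd|exact: fc].
have embE w (j : 'I_#|A|) : emb w ord0 (enum_val j) = d (enum_val j) * w ord0 j.
  rewrite mxE; case: pickP => [j' /eqP/enum_val_inj-> //|/(_ j)].
  by rewrite eqxx.
have ofA i : c ord0 i != 0 -> exists j : 'I_#|A|, enum_val j = i.
  by move=> ci; exists (enum_rank_in (A := A) ci i); rewrite enum_rankK_in.
have emb0 w i : c ord0 i = 0 -> emb w ord0 i = 0.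
  move=> ci; rewrite mxE; case: pickP => // j /eqP ji.
  by have := d0 j; rewrite ji /d ci mulr0 eqxx.
exists (fun z => (proj z.1, proj z.2)), (fun w => (emb w.1, emb w.2)); split.
- by split; apply: continuous_subspaceT; exact: pairc.
- move=> z /levelP zE j; rewrite /= !mxE.
  transitivity (sqamp z (enum_val j) / d (enum_val j) ^+ 2).
    by rewrite /sqamp; field.
  by rewrite zE -/(d (enum_val j)) divff// expf_neq0.
- move=> w wE; apply/levelP => i; rewrite /sqamp/=.
  have [ci|/ofA[j <-]] := eqVneq (c ord0 i) 0.
    by rewrite !emb0// ci mulr0 expr0n addr0.
  rewrite !embE; transitivity (d (enum_val j) ^+ 2 * (w.1 ord0 j ^+ 2 + w.2 ord0 j ^+ 2)).
    by ring.
  by rewrite wE mulr1.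
- move=> z; rewrite inE => /levelP zE.
  have key (x : 'rV[R]_n.+1) i :
      (c ord0 i = 0 -> x ord0 i = 0) -> emb (proj x) ord0 i = x ord0 i.
    move=> x0; have [ci|/ofA[j <-]] := eqVneq (c ord0 i) 0; first by rewrite emb0 ?x0.
    by rewrite embE mxE mulrC divfK.
  have z0 i : c ord0 i = 0 -> z.1 ord0 i = 0 /\ z.2 ord0 i = 0.
    move=> ci; have := zE i; rewrite /sqamp ci mulr0 expr0n/= => /eqP.
    by rewrite paddr_eq0 ?sqr_ge0// !sqrf_eq0 => /andP[/eqP ? /eqP ?].
  rewrite [RHS]surjective_pairing; congr pair; apply/rowP => i; apply: key => ci;
  by have [] := z0 i ci.
- move=> w _; rewrite [RHS]surjective_pairing.
  by congr pair; apply/rowP => j; rewrite mxE embE mulrC mulKf.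
Qed.

(** The torus is cut out by closed conditions inside a product of cubes with sides [-1, 1]. *)
Lemma standard_torus_compact (R : realType) (k : nat) : compact (standard_torus R k).
Proof.
have cube : compact [set x : 'rV[R]_k | forall i, [set` `[-1, 1]] (x ord0 i)].
  apply: (@rV_compact R k (fun=> [set` `[-1, 1]])) => i; exact: segment_compact.
apply: (subclosed_compact _ (compact_setX cube cube)) => [|w wE]; last first.
  split=> i /=; rewrite in_itv/= -ler_norml -(ler_pXn2r (n := 2)) ?nnegrE//;
    rewrite expr1n real_normK ?num_real//;
  by rewrite -(wE i) ?lerDl ?lerDr sqr_ge0.
rewrite (_ : standard_torus R k =
  \bigcap_(i : 'I_k) ((fun w : 'rV[R]_k * 'rV[R]_k =>
    w.1 ord0 i ^+ 2 + w.2 ord0 i ^+ 2) @^-1` [set 1])); last first.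
  by apply/seteqP; split=> [w wE i _|w wE i]; [exact: wE | exact: (wE i I)].
apply: closed_bigI => i _; apply: closed_comp; last exact: closed_eq.
by move=> w _; exact: continuous_coord_sqnorm.
Qed.

(** S is the image of the compact standard torus under the inverse homeomorphism. *)
Lemma hypertorus_compact (R : realType) (n k : nat) (S : set (state R n)) :
  hypertorus k S -> compact S /\ S !=set0.
Proof.
move=> [f [g [[_ gc] fS gS fgK gK]]].
have <- : g @` standard_torus R k = S.
  apply/seteqP; split=> [_ [w Tw <-]|z Sz]; first exact: gS.
  by exists (f z); [exact: fS|rewrite fgK ?inE].
split; first exact: continuous_compact gc (@standard_torus_compact R k).
(* The point with all angles zero shows that the standard torus is nonempty. *)
by exists (g (const_mx 1, const_mx 0)); eexists; last reflexivity;
  move=> i /=; rewrite !mxE expr1n expr0n addr0.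
Qed.

Lemma amplitude_continuous (R : realType) (n : nat) (i : 'I_n.+1) :
  continuous (fun z : state R n => amplitude z i).
Proof.
move=> z; apply: (@continuous_comp _ _ _ (fun z : state R n => sqamp z i) Num.sqrt);
  last exact: sqrt_continuous.
exact: continuous_coord_sqnorm.
Qed.

(** The radial rescaling by r2 / r1 moves each coordinate of plane i by at most |r1 - r2| c_i /
    c_1. *)
Lemma leaf_level_close (R : realType) (n : nat) (c : 'rV[R]_n.+1) (r1 r2 e : R)
    (z : state R n) :
  (forall i, 0 <= c ord0 i) -> c ord0 (idx1 n) != 0 -> 0 < r1 -> 0 < r2 ->
  (forall i, `|r1 - r2| * (c ord0 i / c ord0 (idx1 n)) < e) ->
  leaf_level c r1 z -> exists2 z', leaf_level c r2 z' & ball z e z'.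
Proof.
move=> hc hc1 r10 r20 he /(leaf_levelP _ hc hc1 r10) zE.
have c1 : 0 < c ord0 (idx1 n) by rewrite lt_neqAle eq_sym hc1 hc.
have e0 : 0 < e by apply: le_lt_trans (he (idx1 n)); rewrite mulr_ge0// divr_ge0.
have close (x : R) i : x ^+ 2 <= sqamp z i -> `|x - r2 / r1 * x| < e.
  rewrite zE => xi; apply: le_lt_trans (he i).
  have {}xi : `|x| <= r1 / c ord0 (idx1 n) * c ord0 i.
    have nn : 0 <= r1 / c ord0 (idx1 n) * c ord0 i.
      by rewrite mulr_ge0// divr_ge0// ltW.
    by rewrite -(ler_pXn2r (n := 2)) ?nnegrE// real_normK ?num_real.
  rewrite (_ : x - _ = (r1 - r2) / r1 * x); last by field; rewrite gt_eqF.
  rewrite !normrM normfV (gtr0_norm r10) -mulrA ler_wpM2l//.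
  rewrite ler_pdivrMl//; apply: le_trans xi _.
  by rewrite le_eqVlt; apply/orP; left; apply/eqP; ring.
exists (\row_i (r2 / r1 * z.1 ord0 i), \row_i (r2 / r1 * z.2 ord0 i)).
  apply/(leaf_levelP _ hc hc1 r20) => i.
  rewrite /sqamp/= !mxE !exprMn -mulrDr -[X in _ * X]/(sqamp z i) zE.
  by field; rewrite hc1 gt_eqF.
split; split => // i j; rewrite mxE (ord1 i); apply: (close _ j).
  by rewrite lerDl sqr_ge0.
by rewrite lerDr sqr_ge0.
Qed.

Lemma leaf_level_hausdorff (R : realType) (n : nat) (c : 'rV[R]_n.+1)
    (F : set_system R) (FF : Filter F) (rho : R -> R) (rho0 : R) :
  (forall i, 0 <= c ord0 i) -> c ord0 (idx1 n) != 0 -> 0 < rho0 ->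
  rho mu @[mu --> F] --> rho0 ->
  hausdorff_cvg F (fun mu => leaf_level c (rho mu)) (leaf_level c rho0).
Proof.
move=> hc hc1 rho00 cv e e0.
have c1 : 0 < c ord0 (idx1 n) by rewrite lt_neqAle eq_sym hc1 hc.
(* The extra 1 makes C strictly larger than every ratio c_i / c_1, so one bound serves all
   coordinates. *)
pose C := 1 + \sum_i c ord0 i / c ord0 (idx1 n).
have Ci i : c ord0 i / c ord0 (idx1 n) < C.
  rewrite /C (bigD1 i)//= addrCA ltrDl ltr_wpDr// sumr_ge0// => j _.
  by rewrite divr_ge0.
have C0 : 0 < C by apply: le_lt_trans (Ci (idx1 n)); rewrite divr_ge0.
near=> mu.
have pos : 0 < rho mu by near: mu; exact: (cvgr_gt rho0).
have near_rho : `|rho0 - rho mu| < e / C.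
  by near: mu; apply: cvgr_dist_lt => //; rewrite divr_gt0.
have bound i : `|rho0 - rho mu| * (c ord0 i / c ord0 (idx1 n)) < e.
  apply: le_lt_trans (_ : `|rho0 - rho mu| * C < e); last by rewrite -ltr_pdivlMr.
  by rewrite ler_wpM2l// ltW.
split=> z lz.
  have [|z' lz' zz'] := leaf_level_close hc hc1 pos rho00 _ lz (e := e).
    by move=> i; rewrite distrC.
  by exists z' => //; exact: ball_sym.
by have [z' lz' zz'] := leaf_level_close hc hc1 rho00 pos bound lz; exists z'.
Unshelve. all: by end_near. Qed.

(** A level is nonempty, being a torus; if rho^2 were not a root, invariance would put a point of
    amplitude above rho in the level itself. *)
Lemma flow_invariant_leaf_level (R : realType) (n : nat) (omega c : 'rV[R]_n.+1)
    (fhat : mpoly.mpoly n.+2 R) (mu rho : R) (P : {poly R}) :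
  (forall i, 0 <= c ord0 i) -> c ord0 (idx1 n) != 0 ->
  (forall r, reduced_f fhat c mu r = P.[r ^+ 2]) -> 0 < rho ->
  flow_invariant omega fhat mu (leaf_level c rho) <-> root P (rho ^+ 2).
Proof.
move=> hc hc1 hf rho0; split=> [inv|]; last exact: leaf_level_invariant hf rho0.
apply: contraT => nroot.
have [_ [z0 lz0]] := hypertorus_compact (leaf_level_hypertorus hc hc1 rho0).
have [z [_ /= ->]] := leaf_level_escape hc hc1 hf rho0 nroot inv lz0 lz0.
by rewrite ltxx.
Qed.

(* On a compact invariant set the amplitude is maximal somewhere; were the
   scalar field nonzero there, the flow would increase it in one of the two
   directions of time. *)
Lemma invariant_hypertorus_root (R : realType) (n k : nat) (omega c : 'rV[R]_n.+1)
    (fhat : mpoly.mpoly n.+2 R) (mu : R) (P : {poly R}) (S : set (state R n)) :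
  (forall i, 0 <= c ord0 i) -> c ord0 (idx1 n) != 0 ->
  (forall r, reduced_f fhat c mu r = P.[r ^+ 2]) ->
  hypertorus k S -> S `<=` leaf c -> flow_invariant omega fhat mu S ->
  exists2 rho, 0 < rho & root P (rho ^+ 2).
Proof.
move=> hc hc1 hf /hypertorus_compact[cS S0] Sc inv.
have [|z + zmax] := compact_EVT_max S0 cS (f := fun z => amplitude z (idx1 n)).
  exact/continuous_subspaceT/amplitude_continuous.
rewrite inE => Sz; have [s s0 zE] := Sc _ Sz.
have rho0 : 0 < amplitude z (idx1 n).
  by rewrite zE mulr_gt0// lt_neqAle eq_sym hc1 hc.
exists (amplitude z (idx1 n)) => //; apply: contraT => nroot.
have lz : leaf_level c (amplitude z (idx1 n)) z by split=> //; exists s.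
have [z' Sz'] := leaf_level_escape hc hc1 hf rho0 nroot inv Sz lz.
by rewrite ltNge zmax// inE.
Qed.

(** * The bifurcation *)

Lemma at_right_cvg0 (R : realType) (T : Type) (F : set_system T) (FF : Filter F)
    (v : T -> R) :
  v x @[x --> F] --> 0 -> (\forall x \near F, 0 < v x) -> v x @[x --> F] --> 0^'+.
Proof.
move=> cv vpos A nA; have := cv _ nA.
by apply: filterS2 vpos => x /= v0; apply.
Qed.

Section Bifurcation.
Context {R : realType} (alpha a b : R) (p q : nat).
Hypotheses (alpha_gt0 : 0 < alpha) (p_gt0 : (0 < p)%N) (ltpq : (p < q)%N)
  (ab_lt0 : a * b < 0).
Local Notation rs := (rstar a b p q).
Local Notation ms := (mustar a b p q).
Local Notation w := (well rs p q).
Local Notation G := (amplitude_field alpha a b p q).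

Let pR : 0 < p%:R :> R. Proof. by rewrite ltr0n. Qed.
Let qR : 0 < q%:R :> R. Proof. by rewrite ltr0n (ltn_trans p_gt0). Qed.
Let pqR : 0 < q%:R - p%:R :> R. Proof. by rewrite subr_gt0 ltr_nat. Qed.
Let b_neq0 : b != 0.
Proof. by apply/eqP => b0; move: ab_lt0; rewrite b0 mulr0 ltxx. Qed.

Lemma rstar_base_gt0 : 0 < - (p%:R * a) / (q%:R * b).
Proof.
rewrite (_ : _ / _ = p%:R / q%:R * (- (a * b)) / b ^+ 2); last first.
  by field; rewrite b_neq0 gt_eqF.
by rewrite divr_gt0 ?exprn_even_gt0 ?b_neq0 ?orbT// mulr_gt0 ?divr_gt0// oppr_gt0.
Qed.

Lemma rstar_gt0 : 0 < rs.
Proof. exact/powR_gt0/rstar_base_gt0. Qed.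

(** Raising to the power 2n clears the 2 in the exponent 1 / (2(q - p)), so every even power is a
    real power of the same base. *)
Lemma rstar_exp n : rs ^+ (2 * n) =
  (- (p%:R * a) / (q%:R * b)) `^ (n%:R / (q%:R - p%:R)).
Proof.
rewrite -powR_mulrn ?(ltW rstar_gt0)// -powRrM natrM; congr (_ `^ _).
by field; rewrite gt_eqF.
Qed.

(** The critical point equation of a r^(2p) + b r^(2q); it serves to eliminate a from later
    identities. *)
Lemma rstar_expB : q%:R * b * rs ^+ (2 * (q - p)) = - (p%:R * a).
Proof.
rewrite rstar_exp.
rewrite natrB; last exact: ltnW.
rewrite divff; last by rewrite gt_eqF.
rewrite powRr1; last exact: ltW rstar_base_gt0.
by field; rewrite b_neq0 gt_eqF.
Qed.

Lemma mustarE : ms = b / p%:R * well_top rs p q.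
Proof.
rewrite /mustar -rstar_exp /well_top (expr2q ltpq rs).
move: rstar_expB; move: (rs ^+ (2 * p)) (rs ^+ _) => y x E.
have -> : a = - (q%:R * b * x) / p%:R.
  by rewrite E opprK mulrAC divff ?mul1r// gt_eqF.
by field; rewrite !gt_eqF.
Qed.

Lemma mustar_scaled : p%:R / b * ms = well_top rs p q.
Proof. by rewrite mustarE; field; rewrite b_neq0 gt_eqF. Qed.

(** Once a is eliminated through [rstar_expB] this is a field identity; questions about zeros pass
    to the level sets of w. *)
Lemma ftilde_well mu r : ftilde alpha a b p q mu r =
  alpha * (b / p%:R) * (w.[r] - p%:R / b * (ms - mu)).
Proof.
rewrite (mulrBr (p%:R / b)) mustar_scaled -well_0// !wellE /ftilde.
rewrite !expr0n !muln_eq0/= !eqn0Ngt p_gt0 (ltn_trans p_gt0 ltpq)/=.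
rewrite (expr2q ltpq rs); move: rstar_expB.
move: (rs ^+ (2 * p)) (rs ^+ _) (r ^+ (2 * p)) (r ^+ (2 * q)) => y x u v E.
have -> : a = - (q%:R * b * x) / p%:R.
  by rewrite E opprK mulrAC divff ?mul1r// gt_eqF.
by field; rewrite b_neq0 gt_eqF.
Qed.
Let k_neq0 : alpha * (b / p%:R) != 0.
Proof. by rewrite mulf_neq0 ?(gt_eqF alpha_gt0)// mulf_neq0// invr_eq0 gt_eqF. Qed.

(** The polynomial form lets derivatives be computed formally. *)
Lemma amplitude_field_poly mu : G mu =
  horner ((alpha * (b / p%:R)) *: ('X * (w - (p%:R / b * (ms - mu))%:P))).
Proof.
apply/funext => r; rewrite /amplitude_field ftilde_well; move: w => W.
by rewrite hornerZ hornerM hornerX hornerD hornerN hornerC mulrCA.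
Qed.

Lemma equilibriaP mu r :
  equilibria G mu r <-> r = 0 \/ w.[r] = p%:R / b * (ms - mu).
Proof.
rewrite /equilibria/= /amplitude_field ftilde_well; split.
  move/eqP; rewrite mulf_eq0 [X in _ || X]mulf_eq0 (negbTE k_neq0)/= subr_eq0.
  by move=> /orP[/eqP|/eqP]; [left|right].
by move=> [->|->]; rewrite ?subrr !(mul0r, mulr0).
Qed.

Lemma derive1_amplitude_field mu r : derive1 (G mu) r =
  alpha * (b / p%:R) * (w.[r] - p%:R / b * (ms - mu) + r * w^`().[r]).
Proof.
rewrite amplitude_field_poly -derivE; move: w => W.
rewrite derivZ derivM derivX derivB derivC subr0 mul1r.
by rewrite hornerZ !hornerD hornerN hornerC hornerM hornerX.
Qed.

(** At the critical parameter the field is a constant times r w(r), where w has a zero of order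
    exactly two: its second derivative is that constant times r w''(r). The derivative in mu is
    alpha r. *)
Lemma fold_point_rstar r : r ^+ 2 = rs ^+ 2 -> fold_point G ms r.
Proof.
move=> r2.
have nr : `|r| = rs.
  apply: (pexpIrn (n := 2)); rewrite ?nnegrE ?(ltW rstar_gt0)//.
  by rewrite real_normK ?num_real.
have r_neq0 : r != 0 by rewrite -normr_eq0 nr gt_eqF// rstar_gt0.
have wr : w.[r] = 0 by rewrite -well_norm nr well_r0.
have w1 := well_deriv_r0 rstar_gt0 p_gt0 ltpq r2.
have w2 := well_deriv2_r0 rstar_gt0 p_gt0 ltpq r2.
split.
- by apply/equilibriaP; right; rewrite subrr mulr0.
- rewrite amplitude_field_poly subrr mulr0; apply: is_derive_eq.
  move: wr w1; move: w => W W0 W1.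
  by rewrite subr0 derivZ derivM derivX hornerZ hornerD !hornerM W0 W1 !(mulr0, addr0).
- exists (alpha * (b / p%:R) * (r * w^`()^`().[r])).
    by rewrite (mulf_neq0 k_neq0)// mulf_neq0// gt_eqF.
  rewrite amplitude_field_poly subrr mulr0 -derivE; apply: is_derive_eq.
  move: w1; move: w => W W1.
  rewrite subr0 !(derivZ, derivM, derivX, derivD) derivC mul0r add0r mul1r.
  by rewrite hornerZ !hornerD hornerM hornerX W1 !add0r.
- exists (r * alpha); first by rewrite mulf_neq0// gt_eqF.
  rewrite (_ : (fun mu => G mu r) =
    horner ((r * alpha) *: ('X + (a * r ^+ (2 * p) + b * r ^+ (2 * q))%:P))); last first.
    apply/funext => mu; rewrite /amplitude_field /ftilde.
    by rewrite hornerZ hornerD hornerX hornerC; ring.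
  by apply: is_derive_eq; rewrite derivZ derivD derivX derivC addr0 hornerZ hornerC mulr1.
Qed.

Lemma amplitude_field_odd mu r : G mu (- r) = - G mu r.
Proof. by rewrite /amplitude_field !ftilde_well well_opp mulNr. Qed.

Lemma derive1_amplitude_field_even mu r : derive1 (G mu) (- r) = derive1 (G mu) r.
Proof.
rewrite !derive1_amplitude_field well_opp.
by rewrite !well_deriv// !exprM !sqrrN.
Qed.

(** The field is odd in r, so the picture is reflected; order reverses and the two branches exchange
    roles. *)
Lemma collision_opp mu r : collision G mu r -> collision G mu (- r).
Proof.
move=> [s [e [rl [rr [se H [cl cr] E0 H']]]]].
have opp_ball : forall mu x, (equilibria G mu `&` ball (- r) e) x <->
    (equilibria G mu `&` ball r e) (- x).
  move=> mu' x; rewrite /equilibria /ball/= amplitude_field_odd opprK.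
  rewrite (_ : - r - x = - (r + x)); last by rewrite opprD.
  rewrite normrN.
  by split => -[Gx xr]; split => //; [rewrite Gx oppr0 | apply/eqP; rewrite -oppr_eq0 Gx].
exists s, e, (fun h => - rr h), (fun h => - rl h); split => //.
- near=> h; have [lr E D] : [/\ rl h < rr h,
        equilibria G (mu - s * h) `&` ball r e = [set rl h; rr h]
      & derive1 (G (mu - s * h)) (rl h) * derive1 (G (mu - s * h)) (rr h) < 0].
    by near: h.
  split; first by rewrite ltrN2.
    apply/seteqP; split=> x.
      move/opp_ball; rewrite E => -[/= <-|/= <-]; rewrite opprK; first by right.
      by left.
    move=> xE; apply/opp_ball; rewrite E /=.
    by move: xE => -[->|->]; rewrite opprK; [right|left].
  by rewrite !derive1_amplitude_field_even mulrC.
- by split; apply: cvgN.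
- apply/seteqP; split=> x.
    by move/opp_ball; rewrite E0 => /= <-; rewrite opprK.
  by move=> /= ->; apply/opp_ball; rewrite E0 /= opprK.
- near=> h; apply/seteqP; split=> x // /opp_ball.
  by rewrite (near H' h).
Unshelve. all: by end_near. Qed.

(** The colliding equilibria are the roots of w(x) = kap h on the two monotone branches; on the
    other side the level is negative, while w >= 0. *)
Lemma collision_rstar : collision G ms rs.
Proof.
have rs0 := rstar_gt0.
(* The sign s of b selects the side with equilibria: the scaled parameter v is kap h at ms - s h and
   -kap h at ms + s h. *)
pose kap := p%:R / `|b|.
have kap0 : 0 < kap by rewrite divr_gt0 ?normr_gt0.
pose s := Num.sg b.
have sv h : p%:R / b * (ms - (ms - s * h)) = kap * h.
  rewrite subKr /kap {1}(numEsg b) -/s invfM.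
  have ss : s^-1 * s = 1 by rewrite mulVf// sgr_eq0.
  by transitivity (p%:R / `|b| * h * (s^-1 * s)); [ring | rewrite ss mulr1].
have sv' h : p%:R / b * (ms - (ms + s * h)) = - (kap * h).
  by rewrite -sv; ring.
have khc : kap * h @[h --> 0^'+] --> 0^'+.
  apply: at_right_cvg0.
    rewrite -[X in _ --> X](mulr0 kap); apply: cvgM; first exact: cvg_cst.
    exact: cvg_at_right_filter.
  by near=> h; rewrite mulr_gt0.
have khtop := khc _ (nbhs_right_lt (well_top_gt0 rs0 p_gt0 ltpq)).
pose rl h := well_left rs p q (kap * h).
pose rr h := well_right rs p q (kap * h).
have rlc : rl h @[h --> 0^'+] --> rs.
  by apply: (cvg_comp _ _ khc); apply: well_left_cvg.
have rrc : rr h @[h --> 0^'+] --> rs.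
  by apply: (cvg_comp _ _ khc); apply: well_right_cvg.
(* The observed ball of radius [rs] lies in the positive half-line, so neither the origin nor the
   negative equilibria are seen. *)
have ballE x : ball rs rs x -> 0 < x.
  by rewrite /ball/= ltr_norml gtrBl => /andP[].
have s1 : s = 1 \/ s = -1.
  by rewrite /s; case: sgrP b_neq0 => // _ _; [left|right].
exists s, rs, rl, rr; split => //.
- near=> h.
  have h0 : 0 < h by [].
  have kh0 : 0 < kap * h by rewrite mulr_gt0.
  have kht : 0 < kap * h < well_top rs p q.
    by rewrite kh0/=; near: h; exact: khtop.
  (* The right root must lie below 2 rs to be inside the observed ball. *)
  have rr2 : rr h < rs + rs by near: h; apply: (cvgr_lt rs) => //; rewrite ltrDl.
  have [/andP[l0 lr] lv] := well_leftP rs0 p_gt0 ltpq kht.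
  have [rgt rv] := well_rightP rs0 p_gt0 ltpq kh0.
  split; first exact: lt_trans rgt.
    apply/seteqP; split=> x /=.
      move=> [/equilibriaP + /ballE x0]; rewrite sv => -[x00|].
        by rewrite x00 ltxx in x0.
      by move/(well_rootP rs0 p_gt0 ltpq _ kht); rewrite gtr0_norm.
    move=> xE; split.
      by apply/equilibriaP; right; rewrite sv; move: xE => -[->|->].
    rewrite /ball/=; move: xE => [->|->].
      by rewrite gtr0_norm ?subr_gt0// gtrBl.
    by rewrite distrC gtr0_norm ?subr_gt0// ltrBlDl.
  (* At a root of w(x) = v the derivative of the field is a constant times x w'(x). In the product
     the constant is squared, so the sign comes from w'. *)
  rewrite !derive1_amplitude_field sv lv rv subrr !add0r mulrACA.
  rewrite pmulr_rlt0; last by rewrite -expr2 exprn_even_gt0.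
  rewrite mulrACA pmulr_rlt0 ?mulr_gt0 ?(lt_trans rs0 rgt)//.
  by rewrite nmulr_rlt0 ?well_deriv_gt0// well_deriv_lt0// l0.
- apply/seteqP; split=> x /=.
    move=> [/equilibriaP + /ballE x0]; rewrite subrr mulr0 => -[x00|].
      by rewrite x00 ltxx in x0.
    move=> wx; apply/eqP; apply: contraT => xr.
    have := @well_gt0 R rs p q rs0 p_gt0 ltpq x.
    by rewrite gtr0_norm// wx ltxx => /(_ xr).
  move=> ->; split; last exact: ballxx.
  by apply/equilibriaP; right; rewrite subrr mulr0 well_r0.
- near=> h; have h0 : 0 < h by [].
  apply/seteqP; split=> x //= [/equilibriaP + /ballE x0].
  rewrite sv' => -[x00|wx]; first by rewrite x00 ltxx in x0.
  have := @well_ge0 R rs p q rs0 p_gt0 ltpq x.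
  by rewrite wx oppr_ge0 leNgt mulr_gt0.
Unshelve. all: by end_near. Qed.

Lemma saddle_node_rstar : double_saddle_node G ms rs (- rs).
Proof.
have rs0 := rstar_gt0; split.
- by rewrite -subr_eq0 opprK gt_eqF// addr_gt0.
- split; [exact: fold_point_rstar | exact: collision_rstar].
- split; first by apply: fold_point_rstar; rewrite sqrrN.
  exact/collision_opp/collision_rstar.
Qed.

End Bifurcation.

(** * The set of equilibria on each side of the critical parameter *)

Lemma normr_eqP (R : realType) (x l : R) : 0 <= l -> `|x| = l <-> x = l \/ x = - l.
Proof.
move=> l0; split=> [/eqP|[|] ->].
- by rewrite eqr_norml l0 andbT => /orP[] /eqP; [left|right].
- by rewrite ger0_norm.
- by rewrite normrN ger0_norm.
Qed.

Lemma card_eq_uniq (T : eqType) (s : seq T) :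
  uniq s -> ([set x | x \in s] #= `I_(size s))%card.
Proof.
elim: s => [_|x s IH /= /andP[xs us]].
  rewrite (_ : [set x | x \in [::]] = set0) ?II0 ?card_eqxx//.
  by apply/seteqP; split.
apply/eq_cardSP; exists x; first by rewrite /= mem_head.
rewrite (_ : _ `\ x = [set y | y \in s]); first exact: IH.
apply/seteqP; split=> y /=.
  by rewrite inE => -[/orP[/eqP|]].
move=> ys; split; first by rewrite inE ys orbT.
by move=> yx; move: xs; rewrite -yx ys.
Qed.

Lemma card_symmetric_pairs (R : realType) (l r : R) : 0 < l < r ->
  ([set 0; l; r; - l; - r] `\ 0 #= `I_4)%card.
Proof.
move=> /andP[l0 lr]; have r0 := lt_trans l0 lr.
rewrite (_ : _ `\ 0 = [set x | x \in [:: l; r; - l; - r]]).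
  apply: (@card_eq_uniq R [:: l; r; - l; - r]) => /=; rewrite !inE !negb_or !andbT.
  rewrite -!andbA; do 5 (apply/andP; split; first by apply/eqP => ?; lra).
  by apply/eqP => ?; lra.
apply/seteqP; split=> x /=.
  by move=> [[[[[->|->]|->]|->]|->] x0]; rewrite ?inE ?eqxx ?orbT.
rewrite !inE => xE; split.
  case/or4P: xE => /eqP ->; [by do 3 left; right|by do 2 left; right|by left; right|by right].
by move=> x0; move: xE; rewrite x0 => /or4P[] /eqP ?; lra.
Qed.

Section Equilibria.
Context {R : realType} (alpha a b : R) (p q : nat).
Hypotheses (alpha_gt0 : 0 < alpha) (p_gt0 : (0 < p)%N) (ltpq : (p < q)%N)
  (ab_lt0 : a * b < 0).
Local Notation rs := (rstar a b p q).
Local Notation ms := (mustar a b p q).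
Local Notation w := (well rs p q).
Local Notation G := (amplitude_field alpha a b p q).
Local Notation v mu := (p%:R / b * (ms - mu)).
Local Notation rho1 mu := (well_left rs p q (v mu)).
Local Notation rho2 mu := (well_right rs p q (v mu)).

Let rs_gt0 : 0 < rs := rstar_gt0 p_gt0 ltpq ab_lt0.
Let b_neq0 : b != 0.
Proof. by apply/eqP => b0; move: ab_lt0; rewrite b0 mulr0 ltxx. Qed.

(** The window for v covers both signs of a: as v = [well_top] - (p / b) mu, it means 0 < mu < ms
    when b > 0 and ms < mu < 0 when b < 0. *)
Lemma equilibria_four mu : 0 < v mu < well_top rs p q ->
  0 < rho1 mu < rho2 mu /\
  equilibria G mu = [set 0; rho1 mu; rho2 mu; - rho1 mu; - rho2 mu].
Proof.
move=> vt; have [/andP[l0 lr] _] := well_leftP rs_gt0 p_gt0 ltpq vt.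
have /andP[v0 _] := vt; have [rr _] := well_rightP rs_gt0 p_gt0 ltpq v0.
have r0 := lt_trans rs_gt0 rr.
split; first by rewrite l0 (lt_trans lr).
apply/seteqP; split=> x.
  move/(equilibriaP alpha_gt0 p_gt0 ltpq ab_lt0) => [->|]; first by do 4 left.
  move/(well_rootP rs_gt0 p_gt0 ltpq _ vt).
  rewrite !normr_eqP ?ltW// => -[[|]|[|]] ->;
    [by do 3 left; right|by left; right|by do 2 left; right|by right].
move=> xE; apply/(equilibriaP alpha_gt0 p_gt0 ltpq ab_lt0).
move: xE => [[[[|]|]|]|] ->; first (by left); right;
  apply/(well_rootP rs_gt0 p_gt0 ltpq _ vt);
  rewrite ?normrN (gtr0_norm l0, gtr0_norm r0); by [left|right].
Qed.

Lemma equilibria_none mu : v mu < 0 -> equilibria G mu = [set 0].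
Proof.
move=> v0; apply/seteqP; split=> x; last first.
  by move=> ->; apply/(equilibriaP alpha_gt0 p_gt0 ltpq ab_lt0); left.
move/(equilibriaP alpha_gt0 p_gt0 ltpq ab_lt0) => [//|wx].
by have := well_ge0 rs_gt0 p_gt0 ltpq x; rewrite wx leNgt v0.
Qed.

Lemma well_eq0 x : w.[x] = 0 <-> `|x| = rs.
Proof.
rewrite -well_norm; split=> [wx|->]; last exact: well_r0.
apply/eqP; apply: contraT => xr.
by have := well_gt0 rs_gt0 p_gt0 ltpq xr; rewrite -well_norm wx ltxx.
Qed.

Lemma equilibria_mustar : equilibria G ms = [set 0; rs; - rs].
Proof.
apply/seteqP; split=> x.
  move/(equilibriaP alpha_gt0 p_gt0 ltpq ab_lt0) => [->|]; first by left; left.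
  rewrite subrr mulr0 well_eq0 normr_eqP ?ltW// => -[|] ->; [by left; right|by right].
move=> xE; apply/(equilibriaP alpha_gt0 p_gt0 ltpq ab_lt0).
rewrite subrr mulr0 well_eq0 normr_eqP ?ltW//.
by move: xE => [[|]|] ->; [left|right; left|right; right].
Qed.

(** Supplies the polynomial in r^2 on which the invariance criteria rest. *)
Lemma reduced_poly mu : exists P : {poly R},
  forall r, ftilde alpha a b p q mu r = P.[r ^+ 2].
Proof.
exists (alpha *: (mu%:P + a *: 'X^p + b *: 'X^q)) => r.
by rewrite hornerZ !hornerD hornerC !hornerZ !hornerXn -!exprM.
Qed.

Lemma ftilde_eq0 mu r : ftilde alpha a b p q mu r = 0 <-> w.[r] = v mu.
Proof.
rewrite (ftilde_well _ p_gt0 ltpq ab_lt0); split=> [/eqP|->]; last by rewrite subrr mulr0.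
rewrite mulf_eq0 mulf_eq0 gt_eqF//= mulf_eq0 (negbTE b_neq0) invr_eq0 pnatr_eq0.
by rewrite -leqn0 leqNgt p_gt0/= subr_eq0 => /eqP.
Qed.

(** * Invariant tori on the leaf manifold *)

Section LeafManifold.
Variables (n : nat) (omega c : 'rV[R]_n.+1) (fhat : mpoly.mpoly n.+2 R).
Hypotheses (hc : forall i, 0 <= c ord0 i) (hc1 : c ord0 (idx1 n) != 0)
  (hf : forall mu r, reduced_f fhat c mu r = ftilde alpha a b p q mu r).

Lemma invariant_level mu rho : 0 < rho ->
  flow_invariant omega fhat mu (leaf_level c rho) <-> w.[rho] = v mu.
Proof.
move=> rho0; have [P PE] := reduced_poly mu.
have hP r : reduced_f fhat c mu r = P.[r ^+ 2] by rewrite hf.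
rewrite (flow_invariant_leaf_level omega hc hc1 hP rho0) -ftilde_eq0 PE.
by split=> /eqP.
Qed.

Lemma invariant_levels_two mu : 0 < v mu < well_top rs p q ->
  [set rho | 0 < rho /\ flow_invariant omega fhat mu (leaf_level c rho)] =
  [set rho1 mu; rho2 mu].
Proof.
move=> vt; have [/andP[l0 lr] _] := equilibria_four vt.
apply/seteqP; split=> x /=.
  move=> [x0] /(invariant_level _ x0) /(well_rootP rs_gt0 p_gt0 ltpq _ vt).
  by rewrite gtr0_norm.
move=> xE; have x0 : 0 < x by case: xE => -> //; exact: lt_trans lr.
split => //; apply/(invariant_level _ x0)/(well_rootP rs_gt0 p_gt0 ltpq _ vt).
by rewrite gtr0_norm.
Qed.

Lemma invariant_levels_mustar :
  [set rho | 0 < rho /\ flow_invariant omega fhat ms (leaf_level c rho)] = [set rs].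
Proof.
apply/seteqP; split=> x /=.
  move=> [x0] /(invariant_level _ x0); rewrite subrr mulr0 well_eq0.
  by rewrite gtr0_norm.
move=> ->; split => //; apply/invariant_level => //.
by rewrite subrr mulr0 well_r0.
Qed.

(** An invariant torus in the leaf, of whatever dimension, would yield a zero of [ftilde], hence a
    point where the nonnegative w takes a negative value. *)
Lemma no_invariant_hypertorus mu : v mu < 0 ->
  ~ exists (k : nat) (S : set (state R n)),
    [/\ hypertorus k S, S `<=` leaf c & flow_invariant omega fhat mu S].
Proof.
move=> v0 [k [S [hS Sc inv]]]; have [P PE] := reduced_poly mu.
have hP r : reduced_f fhat c mu r = P.[r ^+ 2] by rewrite hf.
have [rho _ /eqP] := invariant_hypertorus_root hc hc1 hP hS Sc inv.
rewrite -PE => /ftilde_eq0 E.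
by have := well_ge0 rs_gt0 p_gt0 ltpq rho; rewrite E leNgt v0.
Qed.

End LeafManifold.
End Equilibria.

(** * The bifurcation scenario for both signs of [a] *)

Unset Implicit Arguments.
Set Strict Implicit.
Set Printing Implicit Defensive.

Theorem theorem3p7 (R : realType) (alpha a b : R) (p q : nat)
    (halpha : 0 < alpha) (hp : (0 < p)%N) (hpq : (p < q)%N) (hab : a * b < 0) :
  let G := amplitude_field alpha a b p q in
  let ms := mustar a b p q in
  let rs := rstar a b p q in
  [/\ (* bifurcation on the transition variety *)
      (forall mu, T2SN a b p q mu -> double_saddle_node G mu rs (- rs)),
      (* a > 0 *)
      (0 < a ->
        (forall mu, ms < mu < 0 ->
           equilibria G mu 0 /\ (equilibria G mu `\ 0 #= `I_4)%card) /\
        (forall mu, mu < ms -> equilibria G mu = [set 0]))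
    & (* a < 0 *)
      (a < 0 -> exists rho1 rho2 : R -> R,
        [/\ (* two pairs of equilibria, which coalesce and disappear *)
            (forall mu, 0 < mu < ms ->
               0 < rho1 mu < rho2 mu /\
               equilibria G mu =
                 [set 0; rho1 mu; rho2 mu; - rho1 mu; - rho2 mu]),
            (rho1 mu @[mu --> ms^'-] --> rs) /\ (rho2 mu @[mu --> ms^'-] --> rs),
            equilibria G ms = [set 0; rs; - rs],
            (forall mu, ms < mu -> equilibria G mu = [set 0])
          & (* two hypertori in the leaf, which coalesce and disappear *)
            forall (n : nat) (hn : (0 < n)%N) (omega c : 'rV[R]_n.+1)
              (hc : forall i, 0 <= c ord0 i) (hc1 : c ord0 (idx1 n) != 0)
              (fhat : mpoly.mpoly n.+2 R)
              (hf : forall mu r,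
                 reduced_f fhat c mu r = ftilde alpha a b p q mu r),
            [/\ (forall mu, 0 < mu < ms ->
                   [/\ hypertorus (torus_dim c) (leaf_level c (rho1 mu)),
                       hypertorus (torus_dim c) (leaf_level c (rho2 mu))
                     & [set rho | 0 < rho /\
                         flow_invariant omega fhat mu (leaf_level c rho)] =
                       [set rho1 mu; rho2 mu]]),
                hypertorus (torus_dim c) (leaf_level c rs) /\
                [set rho | 0 < rho /\
                   flow_invariant omega fhat ms (leaf_level c rho)] = [set rs],
                hausdorff_cvg ms^'- (fun mu => leaf_level c (rho1 mu))
                  (leaf_level c rs),
                hausdorff_cvg ms^'- (fun mu => leaf_level c (rho2 mu))
                  (leaf_level c rs)
              & forall mu, ms < mu ->
                  ~ exists (k : nat) (S : set (state R n)),
                      [/\ hypertorus k S, S `<=` leaf c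
                        & flow_invariant omega fhat mu S]]])].
Proof.
move=> G ms rs.
have b_neq0 : b != 0 by apply/eqP => b0; move: hab; rewrite b0 mulr0 ltxx.
have rs_gt0 : 0 < rs := rstar_gt0 hp hpq hab.
have p_gt0 : 0 < p%:R :> R by rewrite ltr0n.
(* In this form the bound v < [well_top] is a condition on the sign of mu, once the sign of b is
   known. *)
have top_mu mu : p%:R / b * (ms - mu) = well_top rs p q - p%:R / b * mu.
  by rewrite mulrBr (mustar_scaled hp hpq hab).
split.
- by move=> mu ->; exact: saddle_node_rstar.
(* Here b < 0, so scaling by p / b reverses inequalities and the window with four roots is ms < mu <
   0. *)
- move=> a_gt0; have pb : p%:R / b < 0.
    by rewrite pmulr_rlt0// invr_lt0 -(pmulr_rlt0 b a_gt0).
  split=> mu.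
    move=> /andP[ms_mu mu0]; have vt : 0 < p%:R / b * (ms - mu) < well_top rs p q.
      by rewrite nmulr_rgt0// subr_lt0 ms_mu/= top_mu gtrBl nmulr_rgt0.
    have [lr E] := equilibria_four halpha hp hpq hab vt.
    split; first by apply/(equilibriaP halpha hp hpq hab); left.
    by rewrite E; exact: card_symmetric_pairs.
  by move=> mu_ms; apply: equilibria_none => //; rewrite nmulr_rlt0// subr_gt0.
move=> a_lt0; have pb : 0 < p%:R / b.
  by rewrite divr_gt0// -(nmulr_rlt0 b a_lt0).
have vt mu : 0 < mu < ms -> 0 < p%:R / b * (ms - mu) < well_top rs p q.
  move=> /andP[mu0 mu_ms].
  by rewrite pmulr_rgt0// subr_gt0 mu_ms/= top_mu gtrBl pmulr_rgt0.
have v_lt0 mu : ms < mu -> p%:R / b * (ms - mu) < 0.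
  by move=> mu_ms; rewrite pmulr_rlt0// subr_lt0.
have ms_gt0 : 0 < ms.
  by rewrite -(pmulr_rgt0 _ pb) (mustar_scaled hp hpq hab) well_top_gt0.
(* The scaled parameter tends to 0 from the right, so the limits of the two roots transfer to mu
   tending to ms from the left. *)
have vc : p%:R / b * (ms - mu) @[mu --> ms^'-] --> 0^'+.
  apply: at_right_cvg0; last first.
    by near=> mu; rewrite pmulr_rgt0// subr_gt0.
  rewrite (_ : 0 = p%:R / b * (ms - ms)); last by rewrite subrr mulr0.
  apply: cvgM; first exact: cvg_cst.
  apply: cvgB; first exact: cvg_cst.
  exact: cvg_at_left_filter.
pose rho1 mu := well_left rs p q (p%:R / b * (ms - mu)).
pose rho2 mu := well_right rs p q (p%:R / b * (ms - mu)).
have rho1c : rho1 mu @[mu --> ms^'-] --> rs.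
  by apply: (cvg_comp _ _ vc); apply: well_left_cvg.
have rho2c : rho2 mu @[mu --> ms^'-] --> rs.
  by apply: (cvg_comp _ _ vc); apply: well_right_cvg.
exists rho1, rho2; split => //.
- by move=> mu /vt; exact: equilibria_four.
- exact: equilibria_mustar.
- by move=> mu /v_lt0; exact: equilibria_none.
move=> n hn omega c hc hc1 fhat hf; split.
- move=> mu /vt mu_vt; have [/andP[r1 r12] _] := equilibria_four halpha hp hpq hab mu_vt.
  split; [exact: leaf_level_hypertorus | |
    exact: (invariant_levels_two halpha _ _ _ _ hc hc1 hf)].
  by apply: leaf_level_hypertorus => //; exact: lt_trans r12.
- split; first exact: leaf_level_hypertorus.
  exact: (invariant_levels_mustar halpha _ _ _ _ hc hc1 hf).
- exact: leaf_level_hausdorff.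
- exact: leaf_level_hausdorff.
- by move=> mu /v_lt0; exact: (no_invariant_hypertorus halpha _ _ _ hc hc1 hf).
Unshelve. all: by end_near. Qed.
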